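(* Let $G$ be a finite simple graph on $[n]$, where $n\ge 3$ and $E(G)\neq\emptyset$. Then $R/I_c(G)$ satisfies Serre's condition $(S_2)$ if and only if one of the following conditions holds: (1) $G$ has no isolated vertices and either $G$ is complete or $\operatorname{girth}(G)\ge 5$; (2) $G\cong K_2\sqcup sK_1$ for some $s\ge 1$.
   Context: Let $k$ be a field and $R=k[x_1,\ldots,x_n]$. For $F\subseteq[n]=\{1,\ldots,n\}$ put $x_F=\prod_{i\in F}x_i$, with $x_\emptyset=1$. For a finite simple graph $G$ on vertex set $[n]$, the complementary edge ideal is $I_c(G)=(x_{[n]\setminus e}: e\in E(G))\subseteq R$. The girth of $G$, $\operatorname{girth}(G)$, is the length of a shortest cycle of $G$, with $\operatorname{girth}(G)=\infty$ if $G$ is a forest. A Noetherian ring $A$ satisfies Serre's condition $(S_2)$ if $\operatorname{depth}(A_{\mathfrak p})\ge\min\{2,\dim(A_{\mathfrak p})\}$ for every $\mathfrak p\in\operatorname{Spec}(A)$. $K_2\sqcup sK_1$ denotes the disjoint union of one edge and $s$ isolated vertices. *)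

(* Defs.v *)
From HB Require Import structures.
From mathcomp Require Import all_boot all_order all_algebra ring_quotient.
From mathcomp Require Import boolp classical_sets.
(* The notations of constructive_ereal and of mpoly cannot be loaded together. *)
From mathcomp Require Import -(notations) constructive_ereal.
From mathcomp Require Import mpoly.
From mathcomp Require Import ring.

Set Implicit Arguments.
Unset Strict Implicit.
Unset Printing Implicit Defensive.

Import Order.TTheory GRing.Theory.
Local Open Scope ring_scope.
Local Open Scope quotient_scope.

(* Depth, dimension and girth take values in [extended int] (the type \bar int),
   with sup set0 = -oo and inf set0 = +oo. *)
Definition nat_sup (S : set nat) : extended int :=
  supremum (@ENInf int) [set EFin m%:Z | m in S]%classic.
Definition nat_inf (S : set nat) : extended int :=
  infimum (@EPInf int) [set EFin m%:Z | m in S]%classic.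

Section Localization.
Variables (A : comNzRingType) (p : prime_idealr A).

Record prefraction :=
  Prefraction { numden :> A * A; _ : numden.2 \notin p }.

HB.instance Definition _ := [isSub for numden].
HB.instance Definition _ := [Choice of prefraction by <:].

Lemma denP (x : prefraction) : x.2 \notin p.
Proof. by case: x. Qed.

Lemma one_notin_prime : 1 \notin p.
Proof. by rewrite idealr1. Qed.

Lemma mul_notin_prime u v : u \notin p -> v \notin p -> u * v \notin p.
Proof. by rewrite prime_idealrM negb_or => -> ->. Qed.

Definition loc_equiv (x y : prefraction) : bool :=
  `[< exists2 u, u \notin p & u * (x.1 * y.2 - y.1 * x.2) = 0 >].

Lemma loc_equivP (x y : prefraction) :
  reflect (exists2 u, u \notin p & u * (x.1 * y.2 - y.1 * x.2) = 0)
          (loc_equiv x y).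
Proof. exact: asboolP. Qed.

Lemma loc_equiv_refl : reflexive loc_equiv.
Proof.
move=> x; apply/loc_equivP; exists 1; first exact: one_notin_prime.
by rewrite subrr mulr0.
Qed.

Lemma loc_equiv_sym : ssrbool.symmetric loc_equiv.
Proof.
move=> x y; apply/loc_equivP/loc_equivP => -[u up e]; exists u => //;
  by rewrite -opprB mulrN e oppr0.
Qed.

Lemma loc_equiv_trans : transitive loc_equiv.
Proof.
move=> y x z /loc_equivP[u up e] /loc_equivP[v vp f].
apply/loc_equivP; exists (u * v * y.2).
  by rewrite !mul_notin_prime ?denP.
transitivity (v * z.2 * (u * (x.1 * y.2 - y.1 * x.2))
  + u * x.2 * (v * (y.1 * z.2 - z.1 * y.2))); first by ring.
by rewrite e f !mulr0 addr0.
Qed.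

Canonical loc_equiv_equiv :=
  EquivRel loc_equiv loc_equiv_refl loc_equiv_sym loc_equiv_trans.

Definition localization := {eq_quot loc_equiv}.

HB.instance Definition _ : EqQuotient _ loc_equiv localization :=
  EqQuotient.on localization.
HB.instance Definition _ := Choice.on localization.

Definition loc_pi (x : prefraction) : localization := \pi_localization x.

Lemma loc_piE x y : (loc_pi x = loc_pi y) <-> loc_equiv x y.
Proof. by rewrite /loc_pi; split=> [/eqmodP|h]; last apply/eqmodP. Qed.

Lemma loc_repr x : loc_equiv (repr (loc_pi x)) x.
Proof. by apply/loc_piE; rewrite /loc_pi reprK. Qed.

Lemma loc_piK a : loc_pi (repr a) = a.
Proof. exact: reprK. Qed.

Definition preadd (x y : prefraction) : prefraction :=
  @Prefraction (x.1 * y.2 + y.1 * x.2, x.2 * y.2)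
    (mul_notin_prime (denP x) (denP y)).
Definition premul (x y : prefraction) : prefraction :=
  @Prefraction (x.1 * y.1, x.2 * y.2) (mul_notin_prime (denP x) (denP y)).
Definition preopp (x : prefraction) : prefraction :=
  @Prefraction (- x.1, x.2) (denP x).
Definition preconst (a : A) : prefraction :=
  @Prefraction (a, 1) one_notin_prime.

Definition loc_add (a b : localization) := loc_pi (preadd (repr a) (repr b)).
Definition loc_mul (a b : localization) := loc_pi (premul (repr a) (repr b)).
Definition loc_opp (a : localization) := loc_pi (preopp (repr a)).

Lemma loc_addE x y : loc_add (loc_pi x) (loc_pi y) = loc_pi (preadd x y).
Proof.
apply/loc_piE/loc_equivP => /=.
have /loc_equivP[u up e] := loc_repr x; have /loc_equivP[v vp f] := loc_repr y.
exists (u * v); first exact: mul_notin_prime.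
move: (repr (loc_pi x)) (repr (loc_pi y)) e f => x' y' e f.
transitivity (v * y'.2 * y.2 * (u * (x'.1 * x.2 - x.1 * x'.2))
  + u * x'.2 * x.2 * (v * (y'.1 * y.2 - y.1 * y'.2))); first by ring.
by rewrite e f !mulr0 addr0.
Qed.

Lemma loc_mulE x y : loc_mul (loc_pi x) (loc_pi y) = loc_pi (premul x y).
Proof.
apply/loc_piE/loc_equivP => /=.
have /loc_equivP[u up e] := loc_repr x; have /loc_equivP[v vp f] := loc_repr y.
exists (u * v); first exact: mul_notin_prime.
move: (repr (loc_pi x)) (repr (loc_pi y)) e f => x' y' e f.
transitivity (v * y'.1 * y.2 * (u * (x'.1 * x.2 - x.1 * x'.2))
  + u * x'.2 * x.1 * (v * (y'.1 * y.2 - y.1 * y'.2))); first by ring.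
by rewrite e f !mulr0 addr0.
Qed.

Lemma loc_oppE x : loc_opp (loc_pi x) = loc_pi (preopp x).
Proof.
apply/loc_piE/loc_equivP => /=.
have /loc_equivP[u up e] := loc_repr x; exists u => //.
by rewrite !mulNr -opprD mulrN e oppr0.
Qed.

Lemma loc_eq (x y : prefraction) : x.1 * y.2 = y.1 * x.2 -> loc_pi x = loc_pi y.
Proof.
move=> e; apply/loc_piE/loc_equivP; exists 1; first exact: one_notin_prime.
by rewrite e subrr mulr0.
Qed.

Lemma loc_addA : associative loc_add.
Proof.
move=> a b c; rewrite -(loc_piK a) -(loc_piK b) -(loc_piK c) !loc_addE.
by apply: loc_eq => /=; ring.
Qed.

Lemma loc_addC : commutative loc_add.
Proof.
move=> a b; rewrite -(loc_piK a) -(loc_piK b) !loc_addE.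
by apply: loc_eq => /=; ring.
Qed.

Lemma loc_add0 : left_id (loc_pi (preconst 0)) loc_add.
Proof.
by move=> a; rewrite -(loc_piK a) !loc_addE; apply: loc_eq => /=; ring.
Qed.

Lemma loc_addN : left_inverse (loc_pi (preconst 0)) loc_opp loc_add.
Proof.
move=> a; rewrite -(loc_piK a) loc_oppE loc_addE.
by apply: loc_eq => /=; ring.
Qed.

Lemma loc_mulA : associative loc_mul.
Proof.
move=> a b c; rewrite -(loc_piK a) -(loc_piK b) -(loc_piK c) !loc_mulE.
by apply: loc_eq => /=; ring.
Qed.

Lemma loc_mulC : commutative loc_mul.
Proof.
move=> a b; rewrite -(loc_piK a) -(loc_piK b) !loc_mulE.
by apply: loc_eq => /=; ring.
Qed.

Lemma loc_mul1 : left_id (loc_pi (preconst 1)) loc_mul.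
Proof.
by move=> a; rewrite -(loc_piK a) !loc_mulE; apply: loc_eq => /=; ring.
Qed.

Lemma loc_mulDl : left_distributive loc_mul loc_add.
Proof.
move=> a b c; rewrite -(loc_piK a) -(loc_piK b) -(loc_piK c).
by rewrite !(loc_addE, loc_mulE); apply: loc_eq => /=; ring.
Qed.

Lemma loc_nonzero : loc_pi (preconst 1) != loc_pi (preconst 0).
Proof.
apply/eqP => /loc_piE/loc_equivP[u /negP up /=].
by rewrite mul0r subr0 !mulr1 => u0; apply: up; rewrite u0 idealr0.
Qed.

HB.instance Definition _ :=
  GRing.isZmodule.Build localization loc_addA loc_addC loc_add0 loc_addN.
HB.instance Definition _ :=
  GRing.Zmodule_isComNzRing.Build localization
    loc_mulA loc_mulC loc_mul1 loc_mulDl loc_nonzero.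

End Localization.

Definition ideal_gen (A : comNzRingType) (s : seq A) : {pred A} :=
  fun x => `[< exists c : nat -> A, x = \sum_(i < size s) c i * s`_i >].

Definition prime_chain (A : comNzRingType) (m : nat)
    (c : 'I_m.+1 -> prime_idealr A) : Prop :=
  forall i j : 'I_m.+1, (i < j)%N ->
    {subset c i <= c j} /\ ~ {subset c j <= c i}.

Definition krull_dim (A : comNzRingType) : extended int :=
  nat_sup [set m | exists c : 'I_m.+1 -> prime_idealr A, prime_chain c]%classic.

Definition regular_seq (A : comNzRingType) (s : seq A) : Prop :=
  (forall i, (i < size s)%N -> forall x : A,
     s`_i * x \in ideal_gen (take i s) -> x \in ideal_gen (take i s)) /\
  1 \notin ideal_gen s.

(* Intended for local rings, where the non-units form the maximal ideal. *)
Definition local_depth (A : comNzRingType) : extended int :=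
  nat_sup [set m | exists s : seq A,
    [/\ size s = m, regular_seq s &
        forall x, x \in s -> ~ exists y, x * y = 1]]%classic.

Definition serre_condition (r : nat) (A : comNzRingType) : Prop :=
  forall p : prime_idealr A,
    (Order.min (EFin r%:Z) (krull_dim (localization p))
       <= local_depth (localization p))%O.

Record sgraph (V : finType) := SGraph {
  adj : rel V;
  adj_sym : ssrbool.symmetric adj;
  adj_irrefl : irreflexive adj }.

Section Graphs.
Variables (V : finType) (G : sgraph V).

Definition edges : {set {set V}} :=
  [set e : {set V} | [exists u, exists v, adj G u v && (e == [set u; v])]].

Definition isolated (v : V) : Prop := forall u, ~~ adj G v u.

Definition is_complete : Prop := forall u v, u != v -> adj G u v.

Definition is_cycle (c : seq V) : bool :=
  [&& (2 < size c)%N, uniq c & cycle (adj G) c].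

Definition girth : extended int :=
  nat_inf [set m | exists2 c, is_cycle c & size c = m]%classic.

End Graphs.

Definition isomorphic (V W : finType) (G : sgraph V) (H : sgraph W) : Prop :=
  exists2 f : V -> W, bijective f &
    forall u v, adj H (f u) (f v) = adj G u v.

Section GraphConstructions.

Definition complete_adj n : rel 'I_n := fun u v => u != v.
Lemma complete_adj_sym n : ssrbool.symmetric (@complete_adj n).
Proof. by move=> u v; rewrite /complete_adj eq_sym. Qed.
Lemma complete_adj_irrefl n : irreflexive (@complete_adj n).
Proof. by move=> u; rewrite /complete_adj eqxx. Qed.
Definition complete_graph n : sgraph 'I_n :=
  SGraph (@complete_adj_sym n) (@complete_adj_irrefl n).

Definition edgeless_adj n : rel 'I_n := fun _ _ => false.
Lemma edgeless_adj_sym n : ssrbool.symmetric (@edgeless_adj n).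
Proof. by []. Qed.
Lemma edgeless_adj_irrefl n : irreflexive (@edgeless_adj n).
Proof. by []. Qed.
Definition edgeless_graph n : sgraph 'I_n :=
  SGraph (@edgeless_adj_sym n) (@edgeless_adj_irrefl n).

Variables (V W : finType) (G : sgraph V) (H : sgraph W).
Definition disjoint_adj : rel (V + W) := fun u v =>
  match u, v with
  | inl u, inl v => adj G u v
  | inr u, inr v => adj H u v
  | _, _ => false
  end.
Lemma disjoint_adj_sym : ssrbool.symmetric disjoint_adj.
Proof. by move=> [u|u] [v|v] //=; rewrite adj_sym. Qed.
Lemma disjoint_adj_irrefl : irreflexive disjoint_adj.
Proof. by move=> [u|u] /=; rewrite adj_irrefl. Qed.
Definition disjoint_graph : sgraph (V + W)%type :=
  SGraph disjoint_adj_sym disjoint_adj_irrefl.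

End GraphConstructions.

Section ComplementaryEdgeIdeal.
Variables (k : fieldType) (n : nat) (G : sgraph 'I_n).

Definition sqfree_monomial (F : {set 'I_n}) : {mpoly k[n]} :=
  \prod_(i in F) 'X_i.

Definition comp_edge_gens : seq {mpoly k[n]} :=
  [seq sqfree_monomial (~: e) | e <- enum (edges G)].

Definition comp_edge_pred : {pred {mpoly k[n]}} := ideal_gen comp_edge_gens.

Lemma comp_edge_pred_closed : (2 < n)%N -> idealr_closed comp_edge_pred.
Proof.
move=> n_gt2; split.
- apply/asboolP; exists (fun=> 0).
  by rewrite big1 // => i _; rewrite mul0r.
- apply/asboolP => -[c /(congr1 (meval (fun=> 0)))].
  rewrite rmorph1 rmorph_sum /= big1 => [/eqP|i _]; first by rewrite oner_eq0.
  have : comp_edge_gens`_i \in comp_edge_gens by rewrite mem_nth.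
  case/mapP => e; rewrite mem_enum inE => /existsP[u /existsP[v /andP[_ /eqP->]]] ->.
  have /card_gt0P[w wF] : (0 < #|~: [set u; v]|)%N.
    rewrite cardsCs finset.setCK card_ord cards2 subn_gt0.
    by apply: leq_ltn_trans n_gt2; case: (u != v).
  rewrite rmorphM /sqfree_monomial (bigD1 w) //= rmorphM /= mevalXU.
  by rewrite mul0r mulr0.
- move=> a x y /asboolP[c ->] /asboolP[d ->]; apply/asboolP.
  exists (fun i => a * c i + d i); rewrite mulr_sumr -big_split /=.
  by apply: eq_bigr => i _; rewrite mulrDl mulrA.
Qed.

(* The library forms R/I only for proper I; for n = 2 and G = K_2 the ideal
   would be the unit ideal. *)
Definition comp_edge_ideal (n_gt2 : (2 < n)%N) :
    idealr ({mpoly k[n]} : comNzRingType) :=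
  HB.pack_for (idealr ({mpoly k[n]} : comNzRingType)) comp_edge_pred
    (isIdealr.Build _ _ (comp_edge_pred_closed n_gt2)).

End ComplementaryEdgeIdeal.

(* Main.v *)
Require Import Defs.
From mathcomp Require Import all_boot all_order all_algebra ring_quotient.
From mathcomp Require Import -(notations) constructive_ereal.
From HB Require Import structures.
From mathcomp Require Import boolp.
From mathcomp Require classical_sets.
From mathcomp Require Import mpoly ring zify.

Set Implicit Arguments.
Unset Strict Implicit.
Unset Printing Implicit Defensive.

Import Order.TTheory GRing.Theory.

(** Write R for k[x_1, ..., x_n] and P_C for the prime generated by the x_i with
i in C.  A squarefree monomial ideal is the intersection of the primes P_C that
contain it; for I_c(G) these are the P_N with N a set of vertices that lies
inside no edge [mem_comp_edge_idealP].  The minimal such N are the isolated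
vertices, the non-adjacent pairs of non-isolated vertices, and the triangles, so
the irreducible components of R/I_c(G) have codimension 1, 2 or 3.

Necessity is Hartshorne's connectedness argument.  If the components through the
generic point of P_U fall into two nonempty groups that meet only along V(P_U),
then the function equal to 1 on one group and 0 on the other lives on the
punctured spectrum but not on the spectrum, so the localization at P_U has depth
at most 1 [not_depth2_of_split]; under (S_2) it has dimension at most 1.  Cones
over a triangle or over a non-adjacent pair force all components to have the same
codimension, and a 4-cycle without chords gives two components of codimension 2
that meet in codimension 4.  What remains is a complete graph, a graph of girth
at least 5 without isolated vertices, or a single edge with isolated vertices.

Conversely, in these three cases the minimal sets N form a family of sets of one
size c such that, inside every U, any two members are joined by a path of members
in which consecutive ones span a set of size at most c + 1.  Then compatible
functions on the components glue [gluing], and a regular sequence a, b on every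
component is a regular sequence on R/I, provided that a or b survives on the
codimension 1 intersections [glue_regular].  For a prime P, let T be the set of
variables in P; near P only the components P_C with C inside T are visible.
 - If #|T| > c + 1, take a = sum of x_i and b = 1 - prod of (1 - x_i) over T.
 - If #|T| = c + 1, take the same a and any b in P outside P_T; when P = P_T the
   dimension is 1.
 - If #|T| = c, then R/I is a polynomial ring near P.  With W a maximal set of
   variables that are algebraically independent modulo P, two further variables
   x_i and x_j give elements a of k[W, x_i] and b of k[W, x_j] in P, and these
   form a regular sequence; with at most one further variable, the dimension is
   at most 1 [regular_pair_of_chain].

Everything is carried out in R: dimension and depth of the localization of R/I
at P are expressed by primes between I and P, and by congruences modulo I up to
factors outside P [serre2P]. *)

(** * Prime ideals as predicates *)
Section PrimeIdeals.
Local Open Scope ring_scope.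

(** Unlike [prime_idealr], this asks for no boolean membership test: contractions and
extensions of primes are described by existential statements. *)
Record prime_ideal (R : comNzRingType) (Q : R -> Prop) : Prop := PrimeIdeal {
  prime0 : Q 0;
  primeD : forall x y, Q x -> Q y -> Q (x + y);
  primeM : forall a x, Q x -> Q (a * x);
  prime_proper : ~ Q 1;
  prime_split : forall x y, Q (x * y) -> Q x \/ Q y }.

Variables (R : comNzRingType) (Q : R -> Prop) (Qprime : prime_ideal Q).

Lemma primeN x : Q x -> Q (- x).
Proof. by move=> Qx; rewrite -mulN1r; apply: primeM. Qed.

Lemma primeB x y : Q x -> Q y -> Q (x - y).
Proof. by move=> Qx /primeN; apply: primeD. Qed.

Lemma primeMr a x : Q x -> Q (x * a).
Proof. by rewrite mulrC; apply: primeM. Qed.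

Lemma prime_sum (J : Type) (r : seq J) (S : pred J) (F : J -> R) :
  (forall j, S j -> Q (F j)) -> Q (\sum_(j <- r | S j) F j).
Proof.
move=> QF; elim/big_ind: _ => //; [exact: prime0 Qprime | exact: primeD Qprime].
Qed.

Lemma prime_prod (J : Type) (r : seq J) (S : pred J) (F : J -> R) :
  (forall j, S j -> ~ Q (F j)) -> ~ Q (\prod_(j <- r | S j) F j).
Proof.
move=> QF; elim/big_ind: _ => // [|x y nx ny]; first exact: prime_proper Qprime.
by case/(prime_split Qprime).
Qed.

Lemma prime_notM x y : ~ Q x -> ~ Q y -> ~ Q (x * y).
Proof. by move=> nx ny /(prime_split Qprime)[]. Qed.

Lemma prime_idealr_of : exists q : prime_idealr R, forall x, x \in q <-> Q x.
Proof.
pose S : {pred R} := fun x => `[< Q x >].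
have SP x : x \in S <-> Q x by split=> [/asboolP|/asboolP].
have idS : idealr_closed S.
  split.
  - by apply/SP; apply: prime0 Qprime.
  - by apply/negP => /SP /(prime_proper Qprime).
  - move=> a x y /SP Qx /SP Qy; apply/SP; apply: (primeD Qprime) => //.
    exact: primeM.
have prS : prime_idealr_closed S.
  move=> x y /SP /(prime_split Qprime)[Qx|Qy]; apply/orP; [left|right]; exact/SP.
pose q : prime_idealr R := HB.pack_for (prime_idealr R) S
  (isIdealr.Build _ _ idS) (isPrimeIdealrClosed.Build _ _ prS).
by exists q => x; apply: SP.
Qed.

End PrimeIdeals.

Lemma prime_idealrP (R : comNzRingType) (q : prime_idealr R) :
  prime_ideal (fun x => x \in q).
Proof.
split=> [|x y|a x||x y]; [exact: idealr0|exact: rpredD|exact: idealMr| |].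
  by rewrite idealr1.
by rewrite prime_idealrM => /orP.
Qed.

(** * Dimension and depth of a localization, read in the ring below *)
Section Transfer.
Local Open Scope ring_scope.

Variables (R L : comNzRingType) (I P : R -> Prop) (psi : {rmorphism R -> L}).

(** The kernel of R -> (R/I)_P. *)
Definition sat x := exists2 u, ~ P u & I (u * x).

Definition has_chain m := exists Q : 'I_m.+1 -> R -> Prop,
  (forall i, [/\ prime_ideal (Q i), forall x, I x -> Q i x
                & forall x, Q i x -> P x]) /\
  (forall i j : 'I_m.+1, (i < j)%N ->
     (forall x, Q i x -> Q j x) /\ ~ (forall x, Q j x -> Q i x)).

Definition has_depth1 := exists2 a, P a & forall x, sat (a * x) -> sat x.

(** A regular sequence of length 2 in (R/I)_P with denominators cleared: an equation
b g = a h in the localization makes g a multiple of a up to a factor v outside P. *)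
Definition has_depth2 := exists a b,
  [/\ P a, P b, forall x, sat (a * x) -> sat x
    & forall g h, sat (b * g - a * h) ->
        exists v f, ~ P v /\ sat (v * g - a * f)].

(** The hypotheses on psi describe the localization of R/I at P up to isomorphism. *)
Hypotheses (Pprime : prime_ideal P) (subIP : forall x, I x -> P x).
Hypothesis psi_eq0 : forall r, psi r = 0 <-> sat r.
Hypothesis psi_frac : forall y, exists r s, ~ P s /\ y * psi s = psi r.
Hypothesis psi_unit : forall s, ~ P s -> exists t, psi s * t = 1.

Lemma psi_cancel s y : ~ P s -> y * psi s = 0 -> y = 0.
Proof.
move=> /psi_unit[t st1] ys0.
by rewrite -[y]mulr1 -st1 mulrA ys0 mul0r.
Qed.

Definition extension (Q : R -> Prop) (y : L) :=
  exists r s, [/\ Q r, ~ P s & y * psi s = psi r].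

Section Extension.
Variables (Q : R -> Prop) (Qprime : prime_ideal Q).
Hypotheses (subIQ : forall x, I x -> Q x) (subQP : forall x, Q x -> P x).

Lemma extension_num r s y : ~ P s -> y * psi s = psi r -> extension Q y -> Q r.
Proof.
move=> nPs eyr [r' [s' [Qr' nPs' eyr']]].
have /psi_eq0[u nPu /subIQ]: psi (r * s' - r' * s) = 0.
  by rewrite rmorphB !rmorphM -eyr -eyr'; ring.
case/(prime_split Qprime) => [/subQP //|Qrr'].
have: Q (r * s').
  rewrite -[r * s'](subrK (r' * s)); apply: (primeD Qprime) => //.
  exact: primeMr.
by case/(prime_split Qprime) => // /subQP.
Qed.

Lemma extensionE r : extension Q (psi r) <-> Q r.
Proof.
split=> [|Qr].
  apply: (@extension_num _ 1); first exact: prime_proper.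
  by rewrite rmorph1 mulr1.
by exists r, 1; split=> //; [exact: prime_proper | rewrite rmorph1 mulr1].
Qed.

Lemma extension_prime : prime_ideal (extension Q).
Proof.
split.
- by rewrite -(rmorph0 psi); apply/extensionE/(prime0 Qprime).
- move=> y z [r [s [Qr nPs er]]] [r' [s' [Qr' nPs' er']]].
  exists (r * s' + r' * s), (s * s'); split; last 1 first.
  + by rewrite rmorphD !rmorphM -er -er'; ring.
  + by apply: (primeD Qprime); apply: primeMr.
  + exact: prime_notM.
- move=> a y [r [s [Qr nPs er]]]; have [r' [s' [nPs' er']]] := psi_frac a.
  exists (r' * r), (s * s'); split; last 1 first.
  + by rewrite !rmorphM -er -er'; ring.
  + exact: primeM.
  + exact: prime_notM.
- by rewrite -(rmorph1 psi) => /extensionE; apply: prime_proper.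
- move=> y z Qyz.
  have [r [s [nPs er]]] := psi_frac y; have [r' [s' [nPs' er']]] := psi_frac z.
  have: Q (r * r').
    apply: (extension_num (s := s * s')) Qyz; first exact: prime_notM.
    by rewrite !rmorphM -er -er'; ring.
  by case/(prime_split Qprime) => Qr; [left; exists r, s | right; exists r', s'].
Qed.

End Extension.

Lemma psi_nonunit r : P r -> ~ exists t, psi r * t = 1.
Proof.
move=> Pr [t rt1].
have Pe := extension_prime Pprime subIP (fun _ => id).
by apply: (prime_proper Pe); rewrite -rt1; apply: (primeMr Pe); apply/extensionE.
Qed.

(** Contraction and extension are inverse to each other on primes, so chains of primes
of the localization are chains of primes between I and P. *)
Lemma chain_localization m :
  (exists c : 'I_m.+1 -> prime_idealr L, prime_chain c) <-> has_chain m.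
Proof.
split=> [[c chain_c]|[Q [Qp Qchain]]].
  have c_out i s : ~ P s -> ~ psi s \in c i.
    case/psi_unit => t st1 cs.
    by have := idealMr t cs; rewrite mulrC st1 idealr1.
  exists (fun i r => psi r \in c i); split=> [i|i j ltij].
    split=> [|x Ix|x cx]; last by apply: contrapT => /(c_out i).
      have ci := prime_idealrP (c i); split=> [|x y|a x||x y].
      - by rewrite rmorph0; apply: prime0 ci.
      - by rewrite rmorphD; apply: primeD ci _ _.
      - by rewrite rmorphM; apply: primeM ci _ _.
      - by rewrite rmorph1; apply: prime_proper ci.
      - by rewrite rmorphM; apply: prime_split ci _ _.
    suff ->: psi x = 0 by apply: idealr0.
    apply/psi_eq0; exists 1; first exact: (prime_proper Pprime).
    by rewrite mul1r.
  have [cij ncji] := chain_c i j ltij; split=> [x|ncQ]; first exact: cij.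
  apply: ncji => y cy; have [r [s [nPs er]]] := psi_frac y.
  have /ncQ: psi r \in c j by rewrite -er mulrC idealMr.
  by rewrite -er prime_idealrM => /orP[//|/c_out].
have Pe i := let: And3 pQ sI sP := Qp i in extension_prime pQ sI sP.
have /choice[c cE] i := prime_idealr_of (Pe i).
exists c => i j ltij; have [Qij nQji] := Qchain i j ltij.
split=> [y|cji].
  by move=> /cE[r [s [Qr nPs er]]]; apply/cE; exists r, s; split=> //; apply: Qij.
apply: nQji => x; have [pj Ij Pj] := Qp j; have [pi Ii Pi] := Qp i.
by move=> /(extensionE pj Ij Pj)/cE/cji/cE/(extensionE pi Ii Pi).
Qed.

Lemma mem_ideal_gen0 (x : L) : x \in ideal_gen [::] <-> x = 0.
Proof.
split=> [/asboolP[c ->]|->]; first by rewrite big_ord0.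
by apply/asboolP; exists (fun=> 0); rewrite big_ord0.
Qed.

Lemma mem_ideal_gen1 (a x : L) : x \in ideal_gen [:: a] <-> exists c, x = c * a.
Proof.
split=> [/asboolP[c ->]|[c ->]]; first by rewrite big_ord1; exists (c 0%N).
by apply/asboolP; exists (fun=> c); rewrite big_ord1.
Qed.

Definition regular_of_size m := exists s : seq L,
  [/\ size s = m, regular_seq s & forall x, x \in s -> ~ exists y, x * y = 1].

Lemma ideal_gen_proper (s : seq R) :
  (forall x, x \in s -> P x) -> 1 \notin ideal_gen [seq psi x | x <- s].
Proof.
move=> Ps; have Pe := extension_prime Pprime subIP (fun _ => id).
apply/negP => /asboolP[c e1]; apply: (prime_proper Pe); rewrite e1.
apply: (prime_sum Pe) => i _; apply: (primeM Pe).
rewrite (nth_map 0) -?(size_map psi) //; apply/extensionE => //.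
by apply: Ps; rewrite mem_nth // -(size_map psi).
Qed.

Lemma regular0 : regular_of_size 0.
Proof.
by exists [::]; split=> //; split=> //; apply: (@ideal_gen_proper [::]).
Qed.

Lemma psi_eq x y : psi x = psi y <-> sat (x - y).
Proof.
rewrite -psi_eq0 rmorphB; split=> [->|/eqP]; first by rewrite subrr.
by rewrite subr_eq0 => /eqP.
Qed.

Lemma psi_regular a : (forall x, sat (a * x) -> sat x) ->
  forall y, psi a * y = 0 -> y = 0.
Proof.
move=> reg_a y ay0; have [r [s [nPs er]]] := psi_frac y.
apply: (psi_cancel nPs); rewrite er; apply/psi_eq0/reg_a/psi_eq0.
by rewrite rmorphM -er mulrA ay0 mul0r.
Qed.

Lemma regular1 : has_depth1 -> regular_of_size 1.
Proof.
case=> a Pa reg_a; exists [:: psi a]; split=> //.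
  split; last by apply: (@ideal_gen_proper [:: a]) => x; rewrite inE => /eqP->.
  case=> // _ x /=; rewrite !mem_ideal_gen0; exact: psi_regular.
by move=> x; rewrite inE => /eqP->; apply: psi_nonunit.
Qed.

Lemma regular2 : has_depth2 -> regular_of_size 2.
Proof.
case=> a [b [Pa Pb reg_a reg_b]]; exists [:: psi a; psi b]; split=> //.
  split; last first.
    by apply: (@ideal_gen_proper [:: a; b]) => x; rewrite !inE => /orP[]/eqP->.
  case=> [|[|//]] _ y /=; rewrite ?mem_ideal_gen0 ?mem_ideal_gen1.
    exact: psi_regular.
  case=> c ebc; have [r [s [nPs er]]] := psi_frac y.
  have [h [t [nPt eh]]] := psi_frac c.
  have /psi_eq/reg_b[v [f [nPv /psi_eq evf]]]:
      psi (b * (t * r)) = psi (a * (h * s)).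
    rewrite !rmorphM -er -eh; transitivity (psi b * y * psi s * psi t).
      by ring.
    by rewrite ebc; ring.
  have [z ez]: exists z, psi (v * t * s) * z = 1.
    by apply: psi_unit; do 2?apply: prime_notM.
  exists (psi f * z); transitivity (y * (psi (v * t * s) * z)).
    by rewrite ez mulr1.
  transitivity (psi (v * (t * r)) * z); last by rewrite evf rmorphM; ring.
  by rewrite !rmorphM -er; ring.
by move=> x; rewrite !inE => /orP[]/eqP->; apply: psi_nonunit.
Qed.

(** Multiplying by a unit of the localization preserves regular sequences, so the first
entry may be taken to be the image of an element of P. *)
Lemma regular_head m : (0 < m)%N -> regular_of_size m ->
  exists y s a t, [/\ regular_seq (y :: s),
    forall x, x \in y :: s -> ~ exists z, x * z = 1, size s = m.-1, ~ P t
    & [/\ y * psi t = psi a, P a & forall x, sat (a * x) -> sat x]].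
Proof.
case: m => // m _ [[|y s] [//= [sz_s] reg_s nu_s]].
have [a [t [nPt ea]]] := psi_frac y.
exists y, s, a, t; split=> //; split=> //.
  apply: contrapT => /psi_unit[q eq1]; apply: (nu_s y); first exact: mem_head.
  by exists (psi t * q); rewrite mulrA ea.
move=> x /psi_eq0; rewrite rmorphM -ea -mulrA mulrC.
have := reg_s.1 0%N isT (psi t * psi x); rewrite /= !mem_ideal_gen0.
by rewrite [_ * y]mulrC => ry /ry; rewrite mulrC => /(psi_cancel nPt)/psi_eq0.
Qed.

Lemma regular_ge1 m : (0 < m)%N -> regular_of_size m -> has_depth1.
Proof.
by move=> m0 /(regular_head m0)[y [s [a [t [_ _ _ _ [_ Pa ra]]]]]]; exists a.
Qed.

Lemma regular_ge2 m : (1 < m)%N -> regular_of_size m -> has_depth2.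
Proof.
move=> m_gt1 /(regular_head (ltnW m_gt1)).
case=> y [[|z s] [a [t [[reg_s _] nu_s sz_s nPt [ea Pa reg_a]]]]].
  by case: m m_gt1 sz_s => [|[]].
have [b [t' [nPt' eb]]] := psi_frac z.
have Pb : P b.
  apply: contrapT => /psi_unit[q eq1]; apply: (nu_s z).
    by rewrite !inE eqxx orbT.
  by exists (psi t' * q); rewrite mulrA eb.
have rz x : (exists c, z * x = c * y) -> exists c, x = c * y.
  by have := reg_s 1%N isT x; rewrite /= !mem_ideal_gen1.
exists a, b; split=> // g h /psi_eq; rewrite !rmorphM -ea -eb => e.
have [|c ec] := rz (psi (t' * g)).
  by exists (psi (t * h)); rewrite !rmorphM mulrA e; ring.
have [f [w [nPw ef]]] := psi_frac c.
exists (w * t' * t), f; split; first by do 2?apply: prime_notM.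
apply/psi_eq; transitivity (psi (t' * g) * (psi w * psi t)).
  by rewrite !rmorphM; ring.
by rewrite ec rmorphM -ef -ea; ring.
Qed.

End Transfer.

(** * Suprema and infima of sets of natural numbers *)
Section ExtendedNaturals.
Import classical_sets.
Implicit Types S K D : set nat.

Let E (m : nat) : extended int := EFin (Posz m).

Lemma le_ext_nat m m' : (E m <= E m')%O = (m <= m').
Proof. by rewrite /E lee_fin. Qed.

Lemma nat_sup_supremums S : S !=set0%classic ->
  (supremums [set E m | m in S] !=set0)%classic.
Proof.
case=> m0 Sm0; have [[M ubM]|nubS] := pselect (exists M, forall m, S m -> m <= M).
  have exS : exists m, `[< S m >] by exists m0; apply/asboolP.
  have ubS m : `[< S m >] -> m <= M by move/asboolP/ubM.
  have [m /asboolP Sm maxm] := ex_maxnP exS ubS.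
  exists (E m); split=> [_ [m' Sm' <-]|y ub_y]; last by apply: ub_y; exists m.
  by rewrite le_ext_nat; apply/maxm/asboolP.
exists (@EPInf int); split=> [y _|y ub_y]; first exact: leey.
case: y ub_y => [r||] ub_y //.
  case: nubS; exists `|r|%N => m Sm.
  have : (E m <= EFin r)%O by apply: ub_y; exists m.
  by rewrite lee_fin; case: r {ub_y} => r //=; rewrite lez_nat.
by have : (E m0 <= @ENInf int)%O by apply: ub_y; exists m0.
Qed.

Lemma nat_sup_ge S m : S m -> (E m <= nat_sup S)%O.
Proof.
by move=> Sm; apply: ge_supremum_Nmem; [apply: nat_sup_supremums|]; exists m.
Qed.

Lemma nat_sup_le S M : (forall m, S m -> m <= M) -> (nat_sup S <= E M)%O.
Proof.
move=> ubM; rewrite /nat_sup /supremum; case: ifPn => [_|/set0P[_ [m Sm _]]].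
  exact: leNye.
have : (supremums [set E m | m in S] !=set0)%classic.
  by apply: nat_sup_supremums; exists m.
case/(xgetPex (@ENInf int)) => _; apply => _ [m' Sm' <-].
by rewrite le_ext_nat ubM.
Qed.

Lemma nat_inf_geP S M : (E M <= nat_inf S)%O <-> forall m, S m -> M <= m.
Proof.
rewrite /nat_inf /infimum; case: ifPn => [/eqP S0|/set0P[_ [m0 Sm0 _]]].
  split=> [_ m Sm|_]; last exact: leey.
  by have : [set E m | m in S]%classic (E m); [exists m | rewrite S0].
have exS : exists m, `[< S m >] by exists m0; apply/asboolP.
have [m /asboolP Sm minm] := ex_minnP exS.
have minE m' : S m' -> (E m <= E m')%O.
  by move=> Sm'; rewrite le_ext_nat; apply/minm/asboolP.
rewrite (@xget_unique _ _ _ (E m)).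
- split=> [|leM]; last by rewrite le_ext_nat leM.
  by rewrite le_ext_nat => leMm m' /minE; rewrite le_ext_nat; apply: leq_trans.
- by split=> [_ [m' /minE ? <-]|y lb_y] //; apply: lb_y; exists m.
move=> y [lb_y min_y]; apply/eqP; rewrite eq_le lb_y /=; last by exists m.
by apply: min_y => _ [m' /minE ? <-].
Qed.

(** Serre's condition for r = 2 compares suprema; it only asks whether the dimension,
and then the depth, reaches 1 and 2. *)
Lemma min2_nat_supP K D : D 0 ->
  (Order.min (E 2) (nat_sup K) <= nat_sup D)%O <->
  (forall j, 0 < j <= 2 -> (exists2 m, j <= m & K m) ->
     exists2 m, j <= m & D m).
Proof.
move=> D0; split=> [minKD j /andP[j_gt0 le_j2] [m le_jm Km]|KD].
  apply: contrapT => noD.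
  have : (nat_sup D <= E j.-1)%O.
    apply: nat_sup_le => m' Dm'; rewrite -ltnS prednK // ltnNge.
    by apply/negP => le_jm'; apply: noD; exists m'.
  move/(le_trans minKD); rewrite leNgt => /negP[].
  apply: (@lt_le_trans _ _ (E j)).
    by rewrite ltNge le_ext_nat -ltnNge prednK.
  rewrite le_min le_ext_nat le_j2 /=; apply: le_trans (nat_sup_ge Km).
  by rewrite le_ext_nat.
have le_sup j m : j <= m -> D m -> (E j <= nat_sup D)%O.
  by move=> le_jm /nat_sup_ge; apply: le_trans; rewrite le_ext_nat.
have [K2|noK2] := pselect (exists2 m, 2 <= m & K m).
  by have [m m2 Dm] := KD 2 isT K2; rewrite ge_min (le_sup _ _ m2 Dm).
rewrite ge_min; apply/orP; right.
have ubK j : ~ (exists2 m, j < m & K m) -> (nat_sup K <= E j)%O.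
  move=> nK; apply: nat_sup_le => m Km; rewrite leqNgt; apply/negP => lt_jm.
  by apply: nK; exists m.
have [K1|noK1] := pselect (exists2 m, 1 <= m & K m).
  have [m m1 Dm] := KD 1 isT K1.
  by apply: le_trans (le_sup _ _ m1 Dm); apply: ubK.
by apply: le_trans (le_sup _ _ (leqnn 0) D0); apply: ubK.
Qed.
End ExtendedNaturals.

(** * Serre's condition for a quotient ring *)
Section SerreQuotient.
Local Open Scope ring_scope.
Local Open Scope quotient_scope.

Variables (R : comNzRingType) (I : idealr R).
Let A : comNzRingType := {ideal_quot I}.
Implicit Types (p : prime_idealr A) (P : R -> Prop).

Lemma frac_morphism p : exists f : {rmorphism A -> localization p},
  forall a, f a = loc_pi (preconst p a).
Proof.
pose f a := loc_pi (preconst p a).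
have fB : zmod_morphism f.
  move=> a b; rewrite /f.
  transitivity (loc_add (loc_pi (preconst p a)) (loc_opp (loc_pi (preconst p b))));
    last by [].
  by rewrite loc_oppE loc_addE; apply: loc_eq => /=; ring.
have fM : monoid_morphism f.
  split=> // a b; rewrite /f.
  transitivity (loc_mul (loc_pi (preconst p a)) (loc_pi (preconst p b)));
    last by [].
  by rewrite loc_mulE; apply: loc_eq => /=; ring.
pose f' : {rmorphism A -> localization p} := HB.pack f
  (GRing.isZmodMorphism.Build _ _ f fB) (GRing.isMonoidMorphism.Build _ _ f fM).
by exists f'.
Qed.

Lemma pi_eq0 x : \pi_A x = 0 <-> x \in I.
Proof.
rewrite -(rmorph0 (\pi_A : {rmorphism R -> A})); split=> [/eqP|Ix].
  by rewrite -Quotient.idealrBE subr0.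
by apply/eqP; rewrite -Quotient.idealrBE subr0.
Qed.

Lemma pi_surj (a : A) : exists r, \pi_A r = a.
Proof. by exists (repr (a : {ideal_quot I})); apply: reprK. Qed.

Lemma germ_morphism p (P : R -> Prop) : (forall x, P x <-> \pi_A x \in p) ->
  exists psi : {rmorphism R -> localization p},
  [/\ forall r, psi r = 0 <-> sat (fun x => x \in I) P r,
      forall y, exists r s, ~ P s /\ y * psi s = psi r
    & forall s, ~ P s -> exists t, psi s * t = 1].
Proof.
move=> PE; have [f fE] := frac_morphism p.
have fracE x : loc_pi x * f x.2 = f x.1.
  rewrite !fE; transitivity (loc_mul (loc_pi x) (loc_pi (preconst p x.2))).
    by [].
  by rewrite loc_mulE; apply: loc_eq => /=; ring.
pose psi : {rmorphism R -> localization p} := f \o \pi_A.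
have psiE r : psi r = f (\pi_A r) by [].
exists psi; split=> [r|y|s nPs].
- rewrite psiE fE; split.
    have ->: 0 = loc_pi (preconst p 0) by rewrite -fE rmorph0.
    move=> /loc_piE/loc_equivP[/= u pu e].
    have [v ev] := pi_surj u; exists v; first by move/PE; rewrite ev (negPf pu).
    by apply/pi_eq0; rewrite rmorphM /= ev -e; ring.
  case=> u nPu /pi_eq0; rewrite rmorphM /= => e.
  rewrite -fE -(rmorph0 f) !fE; apply/loc_piE/loc_equivP => /=.
  exists (\pi_A u); first by apply/negP => /PE.
  by rewrite mulr1 mul0r subr0.
- rewrite -(loc_piK y); case: (repr y) => -[a b] /= pb.
  have [r er] := pi_surj a; have [s es] := pi_surj b.
  exists r, s; rewrite /= er es; split.
    by move/PE; rewrite es (negPf pb).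
  by have := fracE (@Prefraction _ p (a, b) pb).
- have ns : ((1, \pi_A s) : A * A).2 \notin p.
    by apply/negP => /= ps; apply/nPs/PE.
  exists (loc_pi (@Prefraction _ p (1, \pi_A s) ns)).
  by rewrite mulrC (fracE (@Prefraction _ p (1, \pi_A s) ns)) rmorph1.
Qed.

(** Primes of R/I are primes of R containing I, so (S_2) can be tested in R. *)
Lemma serre2P : serre_condition 2 A <->
  forall P, prime_ideal P -> (forall x, x \in I -> P x) ->
    (has_chain (fun x => x \in I) P 1 -> has_depth1 (fun x => x \in I) P) /\
    (has_chain (fun x => x \in I) P 2 -> has_depth2 (fun x => x \in I) P).
Proof.
have krullE p m P : prime_ideal P -> (forall x, x \in I -> P x) ->
    (forall x, P x <-> \pi_A x \in p) ->
    (exists c : 'I_m.+1 -> prime_idealr (localization p), prime_chain c)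
      <-> has_chain (fun x => x \in I) P m.
  move=> Pp IP PE; have [psi [psi0 psif psiu]] := germ_morphism PE.
  exact: chain_localization psi0 psif psiu m.
have has_chain_le P (j m : nat) : (j <= m)%N ->
    has_chain (fun x => x \in I) P m -> has_chain (fun x => x \in I) P j.
  move=> le_jm [Q [Qp Qc]].
  have le_Sjm : (j.+1 <= m.+1)%N by [].
  exists (fun i => Q (widen_ord le_Sjm i)).
  split=> [i|i i' lt_ii']; first exact: Qp.
  exact: Qc.
have min2P p P : prime_ideal P -> (forall x, x \in I -> P x) ->
    (forall x, P x <-> \pi_A x \in p) ->
    (Order.min (EFin (Posz 2)) (krull_dim (localization p))
       <= local_depth (localization p))%O <->
    (has_chain (fun x => x \in I) P 1 -> has_depth1 (fun x => x \in I) P) /\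
    (has_chain (fun x => x \in I) P 2 -> has_depth2 (fun x => x \in I) P).
  move=> Pp IP PE; have [psi [psi0 psif psiu]] := germ_morphism PE.
  have D0 := regular0 Pp IP psi0 psif.
  have krE m := krullE p m P Pp IP PE.
  rewrite min2_nat_supP; last exact: D0.
  split=> [KD|[d1 d2] [|[|[|j]]] //= _ [m le_jm /krE Km]].
  - split=> [c1|c2]; last first.
      have [|m m2 Dm] := KD 2%N isT; first by exists 2%N => //; apply/krE.
      exact: (regular_ge2 Pp psi0 psif psiu m2 Dm).
    have [|m m1 Dm] := KD 1%N isT; first by exists 1%N => //; apply/krE.
    exact: (regular_ge1 psi0 psif psiu m1 Dm).
  - exists 1%N => //; apply: (regular1 Pp IP psi0 psif psiu).
    exact: d1 (has_chain_le _ _ _ le_jm Km).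
  - exists 2%N => //; apply: (regular2 Pp IP psi0 psif psiu).
    exact: d2 (has_chain_le _ _ _ le_jm Km).
split=> [S2 P Pp IP|S2 p].
  have pQ : prime_ideal (fun a : A => exists2 r, \pi_A r = a & P r).
    have PE r : (exists2 r', \pi_A r' = \pi_A r & P r') -> P r.
      case=> r' /eqP; rewrite -subr_eq0 -rmorphB => /eqP/pi_eq0/IP Prr' Pr'.
      by rewrite -[r](subKr r'); apply: primeB.
    split=> [|x y [r <- Pr] [r' <- Pr']|a x [r <- Pr]||x y].
    - by exists 0; [rewrite rmorph0 | apply: prime0 Pp].
    - by exists (r + r'); [rewrite rmorphD | apply: (primeD Pp)].
    - have [s <-] := pi_surj a.
      by exists (s * r); [rewrite rmorphM | apply: (primeM Pp)].
    - rewrite -(rmorph1 (\pi_A : {rmorphism R -> A})) => /PE.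
      exact: prime_proper.
    - have [r <-] := pi_surj x; have [s <-] := pi_surj y.
      rewrite -rmorphM => /PE /(prime_split Pp)[]; first by left; exists r.
      by right; exists s.
  have [p pE] := prime_idealr_of pQ.
  apply/(min2P p) => // x; rewrite pE; split=> [Px|[r /eqP]]; first by exists x.
  rewrite -subr_eq0 -rmorphB => /eqP/pi_eq0/IP Prx Pr.
  by rewrite -[x](subKr r); apply: primeB.
have pp := prime_idealrP p.
have Pp : prime_ideal (fun x : R => \pi_A x \in p).
  split=> [|x y|a x||x y].
  - by rewrite rmorph0; apply: prime0 pp.
  - by rewrite rmorphD; apply: primeD pp _ _.
  - by rewrite rmorphM; apply: primeM pp _ _.
  - by rewrite rmorph1; apply: prime_proper pp.
  - by rewrite rmorphM; apply: prime_split pp _ _.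
have IP x : x \in I -> \pi_A x \in p by move/pi_eq0->; apply: idealr0.
by apply/(min2P p _ Pp IP) => //; apply: S2.
Qed.

End SerreQuotient.

(** * Primes generated by variables *)
Section VariablePrimes.
Local Open Scope ring_scope.

Variables (k : fieldType) (n : nat).
Local Notation R := {mpoly k[n]}.
Implicit Types (f g h : R) (C D : {set 'I_n}) (i : 'I_n) (m : 'X_{1..n}).

Lemma mpoly_ring_ind (Q : R -> Prop) :
  (forall c, Q c%:MP) -> (forall i, Q 'X_i) ->
  (forall f g, Q f -> Q g -> Q (f + g)) ->
  (forall f g, Q f -> Q g -> Q (f * g)) -> forall f, Q f.
Proof.
move=> QC QX QD QM f; rewrite (mpolyE f).
apply: (big_ind Q) => [|//|m _]; first by rewrite -mpolyC0.
rewrite -mul_mpolyC mpolyXE_id; apply: (QM) => //.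
have Q1 : Q 1 by rewrite -mpolyC1.
apply: (big_ind Q) => // i _; elim: (m i) => [|j IHj]; first by rewrite expr0.
by rewrite exprS; apply: QM.
Qed.

Lemma mpoly_rmorph_ext (S : nzRingType) (f g : {rmorphism R -> S}) :
  (forall c, f c%:MP = g c%:MP) -> (forall i, f 'X_i = g 'X_i) -> f =1 g.
Proof.
move=> eqC eqX; apply: mpoly_ring_ind => // x y ex ey.
  by rewrite !rmorphD ex ey.
by rewrite !rmorphM ex ey.
Qed.

Lemma mpoly_rmorph_exists (S : comNzRingType) (b : {rmorphism k -> S})
    (v : 'I_n -> S) : exists phi : {rmorphism R -> S},
  (forall c, phi c%:MP = b c) /\ (forall i, phi 'X_i = v i).
Proof.
exists (mmap b v : {rmorphism R -> S}); split=> [c|i] /=; first exact: mmapC.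
by rewrite mmapX mmap1U.
Qed.

(** Modulo the differences x_i - phi(x_i) the substitution phi is the identity. *)
Lemma subst_sub (phi : {rmorphism R -> R}) f : (forall c, phi c%:MP = c%:MP) ->
  exists h : 'I_n -> R, f - phi f = \sum_i h i * ('X_i - phi 'X_i).
Proof.
move=> phiC.
elim/mpoly_ring_ind: f => [c|i|f g [hf ef] [hg eg]|f g [hf ef] [hg eg]].
- exists (fun=> 0); rewrite phiC subrr big1 // => i _; exact: mul0r.
- exists (fun j => (j == i)%:R); rewrite (bigD1 i) //= eqxx mul1r big1 ?addr0 //.
  by move=> j /negPf->; rewrite mul0r.
- exists (fun i => hf i + hg i).
  under eq_bigr do rewrite mulrDl.
  by rewrite big_split /= -ef -eg rmorphD; ring.
- exists (fun i => f * hg i + phi g * hf i).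
  under eq_bigr do rewrite mulrDl -!mulrA.
  by rewrite big_split /= -!mulr_sumr -ef -eg rmorphM; ring.
Qed.

(** Retraction of R onto the polynomials that avoid the variables of C; its fixed points
are the elements of k[x_i, i not in C]. *)
Definition kill C : R -> R :=
  mmap (@mpolyC n k) (fun i => if i \in C then 0 else 'X_i).
HB.instance Definition _ C := GRing.RMorphism.on (kill C).

Lemma killC C c : kill C c%:MP = c%:MP. Proof. exact: mmapC. Qed.

Lemma killX C i : kill C 'X_i = if i \in C then 0 else 'X_i.
Proof. by rewrite /kill mmapX mmap1U. Qed.

Definition mvars m : {set 'I_n} := [set i | 0 < m i]%N.

Lemma killXm C m :
  kill C 'X_[m] = if [disjoint mvars m & C] then 'X_[m] else 0.
Proof.
rewrite /kill mmapX /mmap1; case: ifPn => [dis|].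
  rewrite mpolyXE_id; apply: eq_bigr => i _; case: ifPn => // iC.
  have /negbT := disjointFl dis iC.
  by rewrite inE -eqn0Ngt => /eqP->; rewrite !expr0.
case/pred0Pn => i /andP[]; rewrite /= inE => mi iC.
by rewrite (bigD1 i) //= iC expr0n eqn0Ngt mi mul0r.
Qed.

Lemma mcoeff_kill C f m :
  (kill C f)@_m = if [disjoint mvars m & C] then f@_m else 0.
Proof.
elim/mpolyind: f => [|c m' f _ _ IHf]; first by rewrite rmorph0 !mcoeff0 if_same.
rewrite rmorphD -mul_mpolyC rmorphM /= killC killXm !mcoeffD IHf !mcoeffCM.
case: ifP => dis'; case: ifP => dis; rewrite ?mcoeff0 ?mulr0 ?addr0 //;
  rewrite mcoeffX; case: eqP => [e|_]; rewrite ?mulr0 ?add0r //.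
all: by rewrite e dis in dis'.
Qed.

Lemma kill_kill C D f : kill C (kill D f) = kill (C :|: D) f.
Proof.
apply: (@mpoly_rmorph_ext _ (kill C \o kill D)) => [c|i] /=; rewrite ?killC //.
by rewrite !killX inE; case: (i \in D); rewrite ?orbT ?rmorph0 ?killX ?orbF.
Qed.

Lemma kill_sub C f :
  exists h : 'I_n -> R, f - kill C f = \sum_(i in C) h i * 'X_i.
Proof.
have [h ->] := subst_sub f (killC C); exists h; rewrite [RHS]big_mkcond /=.
by apply: eq_bigr => i _; rewrite killX; case: ifP; rewrite ?subr0 ?subrr ?mulr0.
Qed.

(** The ideal generated by the variables of C, as a kernel: primality is inherited from
the domain R. *)
Definition varprime C f := kill C f = 0.

Lemma varprime_is_prime C : prime_ideal (varprime C).
Proof.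
split=> [|f g|f g||f g]; rewrite /varprime.
- exact: rmorph0.
- by rewrite rmorphD /= => -> ->; rewrite addr0.
- by rewrite rmorphM /= => ->; rewrite mulr0.
- by rewrite rmorph1 => /eqP; rewrite oner_eq0.
- by rewrite rmorphM /= => /eqP; rewrite mulf_eq0 => /orP[]/eqP->; [left|right].
Qed.

Lemma varprimeX C i : varprime C 'X_i <-> i \in C.
Proof.
rewrite /varprime killX; case: ifP => // _; split=> // /eqP.
by rewrite -msupp_eq0 msuppX.
Qed.

Lemma varprime_kill C f : varprime C (f - kill C f).
Proof. by rewrite /varprime rmorphB /= kill_kill setUid subrr. Qed.

Lemma varprime_sub C (Q : R -> Prop) : prime_ideal Q ->
  (forall i, i \in C -> Q 'X_i) -> forall f, varprime C f -> Q f.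
Proof.
move=> Qp QX f kf0; have [h] := kill_sub C f; rewrite kf0 subr0 => ->.
by apply: prime_sum => // i iC; apply/(primeM Qp)/QX.
Qed.

Lemma varprimeS C D f : C \subset D -> varprime C f -> varprime D f.
Proof.
by move=> /setUidPl; rewrite /varprime => <- e; rewrite -kill_kill e rmorph0.
Qed.

(** P_C is a monomial ideal: membership is decided monomial by monomial. *)
Lemma varprimeP C f :
  varprime C f <-> forall m, m \in msupp f -> ~~ [disjoint mvars m & C].
Proof.
split=> [kf0 m|allm].
  rewrite mcoeff_msupp; apply: contra => dis.
  by have := mcoeff_kill C f m; rewrite kf0 mcoeff0 dis => <-.
apply/mpolyP => m; rewrite mcoeff_kill mcoeff0; case: ifP => // dis.
by apply/eqP; rewrite mcoeff_eq0; apply/negP => /allm; rewrite dis.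
Qed.

End VariablePrimes.

(** * Gluing along components that meet in codimension one *)
Section Gluing.
Local Open Scope ring_scope.

Variables (k : fieldType) (n : nat) (CC : {set {set 'I_n}}) (c : nat).
Local Notation R := {mpoly k[n]}.
Implicit Types (f g h : R) (C D T U : {set 'I_n}) (i : 'I_n) (m : 'X_{1..n}).

Definition adjacent_in U : rel {set 'I_n} :=
  fun C D => [&& D \in CC, D \subset U & #|C :|: D| <= c.+1]%N.

(** Connectedness in codimension one of every localization at a prime P_U, for the
variety whose components are the V(P_C). *)
Definition locally_connected := forall U C D, C \in CC -> D \in CC ->
  C \subset U -> D \subset U -> connect (adjacent_in U) C D.

Definition varinter T f := forall C, C \in CC -> C \subset T -> varprime C f.

(** The component of f that is homogeneous for the grading by the support of monomials;
this grading is fine enough to glue in each degree separately. *)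
Definition support_part (Z : {set 'I_n}) f : R :=
  \sum_(m <- msupp f | mvars m == Z) f@_m *: 'X_[m].

Lemma mcoeff_support_part Z f m :
  (support_part Z f)@_m = if mvars m == Z then f@_m else 0.
Proof.
rewrite /support_part raddf_sum /=.
under eq_bigr do rewrite mcoeffZ mcoeffX.
case: ifPn => mZ; last first.
  rewrite big1 // => m' m'Z; case: eqP => [e|_]; last by rewrite mulr0.
  by move: mZ; rewrite -e m'Z.
have [mf|mf] := boolP (m \in msupp f); last first.
  rewrite memN_msupp_eq0 // big1_seq // => m' /andP[_ m'f].
  by case: eqP => [e|_]; [move: mf; rewrite -e m'f | rewrite mulr0].
rewrite big_mkcond (bigD1_seq m) //= mZ eqxx mulr1 big1 ?addr0 // => m'.
by move/negPf->; rewrite mulr0 if_same.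
Qed.

(** A monomial m is nonzero exactly on the components C disjoint from its support.
Connectedness inside the complement of the support says that the coefficients of m
in the F C coincide, and this common value is the coefficient of the glued function. *)
Lemma gluing T (F : {set 'I_n} -> R) : locally_connected ->
  (forall C D, C \in CC -> D \in CC -> C \subset T -> D \subset T ->
     (#|C :|: D| <= c.+1)%N -> varprime (C :|: D) (F C - F D)) ->
  exists f, forall C, C \in CC -> C \subset T -> varprime C (f - F C).
Proof.
move=> CCconn Fadj.
pose good (Z C : {set 'I_n}) := [&& C \in CC, C \subset T & [disjoint Z & C]].
pose val Z := if [pick C | good Z C] is Some C then F C else 0.
exists (\sum_Z support_part Z (val Z)) => C CCC CT.
apply/mpolyP => m; rewrite mcoeff_kill mcoeff0; case: ifP => // dis_m.
rewrite mcoeffB raddf_sum /= (bigD1 (mvars m)) //= mcoeff_support_part eqxx.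
rewrite big1 ?addr0 => [|Z /negPf nZ]; last first.
  by rewrite mcoeff_support_part eq_sym nZ.
rewrite /val; case: pickP => [D /and3P[CCD DT dis_D]|/(_ C)]; last first.
  by rewrite /good CCC CT dis_m.
have subU (E : {set 'I_n}) : E \subset T -> [disjoint mvars m & E] ->
    E \subset T :\: mvars m.
  by move=> ET dis_E; rewrite subsetD ET disjoint_sym.
have := CCconn _ D C CCD CCC (subU _ DT dis_D) (subU _ CT dis_m).
case/connectP => p; elim: p D CCD {DT} dis_D (subU _ DT dis_D).
  by move=> D _ _ _ /= _ ->; rewrite subrr.
move=> E p IHp D CCD dis_D DU /=.
case/andP => /and3P[CCE EU adjDE] pathp lastp.
have [ET dis_E] : E \subset T /\ [disjoint mvars m & E].
  by move: EU; rewrite subsetD disjoint_sym => /andP[].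
have DT : D \subset T by move: DU; rewrite subsetD => /andP[].
have /(congr1 (mcoeff m)) := Fadj D E CCD CCE DT ET adjDE.
rewrite mcoeff_kill mcoeff0 -setI_eq0 setIUr setU_eq0.
rewrite !setI_eq0 dis_D dis_E mcoeffB => /eqP; rewrite subr_eq0 => /eqP->.
exact: IHp.
Qed.

(** On each component g is a multiple of a, say g = a (F C).  The quotients F C agree on
intersections of adjacent components: if a does not vanish there, because
a (F C) = g = a (F D); if b does not, because b (F C) = h = b (F D). *)
Lemma glue_regular T a b : locally_connected ->
  (forall C, C \in CC -> C \subset T -> ~ varprime C a) ->
  (forall C, C \in CC -> C \subset T -> forall g h, varprime C (b * g - a * h) ->
     exists f, varprime C (g - a * f)) ->
  (forall D, D \subset T -> (#|D| <= c.+1)%N -> ~ varprime D a \/ ~ varprime D b) ->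
  forall g h, varinter T (b * g - a * h) -> exists f, varinter T (g - a * f).
Proof.
move=> CCconn reg_a reg_b notab g h bgah.
have /choice[F FE] C : exists f, C \in CC -> C \subset T -> varprime C (g - a * f).
  have [CCC|] := boolP (C \in CC); last by exists 0.
  have [CT|] := boolP (C \subset T); last by exists 0.
  by have [f ?] := reg_b C CCC CT g h (bgah C CCC CT); exists f.
have [//|C D CCC CCD CT DT cardCD|f fE] := @gluing T F.
  have Ep := varprime_is_prime k (C :|: D).
  have gE E : E \in CC -> E \subset T -> E \subset C :|: D ->
      varprime (C :|: D) (g - a * F E) /\ varprime (C :|: D) (b * F E - h).
    move=> CCE ET subE; split; apply: (varprimeS subE); first exact: FE.
    have : varprime E (a * (b * F E - h)).
      have ->: a * (b * F E - h) = (b * g - a * h) - b * (g - a * F E) by ring.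
      have Pp := varprime_is_prime k E; apply: (primeB Pp); first exact: bgah.
      exact/(primeM Pp)/FE.
    by case/(prime_split (varprime_is_prime k E)) => // /(reg_a E CCE ET).
  have [gC bC] := gE C CCC CT (subsetUl C D).
  have [gD bD] := gE D CCD DT (subsetUr C D).
  have CDT : C :|: D \subset T by rewrite subUset CT.
  case: (notab _ CDT cardCD) => nab.
    have : varprime (C :|: D) (a * (F C - F D)).
      have ->: a * (F C - F D) = (g - a * F D) - (g - a * F C) by ring.
      exact: primeB.
    by case/(prime_split Ep).
  have : varprime (C :|: D) (b * (F C - F D)).
    have ->: b * (F C - F D) = (b * F C - h) - (b * F D - h) by ring.
    exact: primeB.
  by case/(prime_split Ep).
exists f => C CCC CT; have Pp := varprime_is_prime k C.
have ->: g - a * f = (g - a * F C) - a * (f - F C) by ring.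
apply: (primeB Pp); first exact: FE.
exact/(primeM Pp)/fE.
Qed.

End Gluing.

(** * A regular sequence valid on all components *)
Section LinearForm.
Local Open Scope ring_scope.

Variables (k : fieldType) (n : nat) (T : {set 'I_n}).
Local Notation R := {mpoly k[n]}.
Implicit Types (f g h : R) (C D : {set 'I_n}) (i : 'I_n) (m : 'X_{1..n}).

Definition varsum : R := \sum_(i in T) 'X_i.
(** An element of P_T that is nonzero modulo [varsum] on every component of dimension at
least 2 in the variables of T: it takes the value 1 as soon as one of these variables
is 1. *)
Definition varcop : R := 1 - \prod_(i in T) (1 - 'X_i).

Lemma kill_varsum C : kill C varsum = \sum_(i in T :\: C) 'X_i.
Proof.
rewrite rmorph_sum [RHS]big_mkcond [LHS]big_mkcond /=; apply: eq_bigr => i _.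
by rewrite inE killX; case: (i \in C) => //=; case: (i \in T).
Qed.

Lemma varsum_notin C : ~ T \subset C -> ~ varprime C varsum.
Proof.
move/negP/subsetPn => [i iT iC]; rewrite /varprime kill_varsum.
move/(congr1 (mcoeff U_(i)%MM)); rewrite mcoeff0 raddf_sum /= (bigD1 i) /=.
  rewrite mcoeffXU eqxx big1 ?addr0 => [/eqP|j /andP[_ /negPf ji]].
    by rewrite oner_eq0.
  by rewrite mcoeffXU ji.
by rewrite inE iC.
Qed.

Lemma varcop_in (P : R -> Prop) : prime_ideal P ->
  (forall i, i \in T -> P 'X_i) -> P varcop.
Proof.
move=> Pp PX; apply: (varprime_sub (C := T)) => //.
rewrite /varprime rmorphB rmorph1 rmorph_prod /= big1 ?subrr // => i iT.
by rewrite rmorphB rmorph1 /= killX iT subr0.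
Qed.

(** On V(P_C) the equation [varsum] = 0 is solved for one variable x_i.  The quotient is
again a polynomial ring, in which [varcop] stays nonzero. *)
Lemma varsum_varcop_regular C g h : C \subset T -> (#|C|.+1 < #|T|)%N ->
  varprime C (varcop * g - varsum * h) -> exists f, varprime C (g - varsum * f).
Proof.
move=> CT cardC bgah.
have /card_gt1P[i [j [iTC jTC nij]]] : (1 < #|T :\: C|)%N.
  by rewrite cardsDS //; lia.
have [phi [phiC phiX]] := mpoly_rmorph_exists (@mpolyC n k) (fun l =>
  if l \in C then 0 else
  if l == i then - \sum_(l in T :\: C | l != i) 'X_l else 'X_l : R).
have phi_kill f : phi (kill C f) = phi f.
  apply: (@mpoly_rmorph_ext _ _ _ (phi \o kill C) phi) => [d|l] /=.
    by rewrite killC.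
  rewrite killX; case: ifP => // lC; have := phiX l; rewrite lC rmorph0.
  exact: esym.
have iC : i \notin C by move: iTC; rewrite inE => /andP[].
have iE : 'X_i - phi 'X_i = kill C varsum.
  by rewrite kill_varsum phiX (negPf iC) eqxx opprK [RHS](bigD1 i).
have phi_sum : phi varsum = 0.
  rewrite -phi_kill kill_varsum rmorph_sum (bigD1 i) //= phiX (negPf iC) eqxx.
  rewrite addrC; apply/eqP; rewrite subr_eq0; apply/eqP; apply: eq_bigr => l.
  by rewrite inE => /andP[/andP[lC _] li]; rewrite phiX (negPf lC) (negPf li).
have phi_copE : phi varcop = 1 - \prod_(l in T) (1 - phi 'X_l).
  rewrite /varcop rmorphB rmorph1 rmorph_prod; congr (_ - _).
  by apply: eq_bigr => l _; rewrite rmorphB rmorph1.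
have phi_cop : phi varcop != 0.
  apply/eqP => /(congr1 (meval (fun l => (l == j)%:R))).
  have [jC jT] : j \notin C /\ j \in T by move: jTC; rewrite inE => /andP[].
  rewrite phi_copE rmorph0 rmorphB rmorph1 rmorph_prod (bigD1 j) //= rmorphB.
  rewrite rmorph1 phiX (negPf jC) eq_sym (negPf nij) /= mevalXU eqxx subrr.
  by rewrite mul0r subr0 => /eqP; rewrite oner_eq0.
have phi_g : phi g = 0.
  have := congr1 phi bgah; rewrite phi_kill rmorph0 rmorphB !rmorphM.
  rewrite phi_sum mul0r subr0 => /eqP; rewrite mulf_eq0 (negPf phi_cop).
  by move/eqP.
have [q] := subst_sub g phiC; rewrite phi_g subr0 => gE.
exists (q i); rewrite /varprime rmorphB rmorphM gE rmorph_sum (bigD1 i) //=.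
rewrite big1 ?addr0 => [|l li].
  by rewrite !rmorphM iE /= kill_kill setUid mulrC subrr.
rewrite rmorphM rmorphB phiX (negPf li); case: ifP => lC.
  by rewrite rmorph0 /= killX lC subrr mulr0.
by rewrite subrr mulr0.
Qed.

End LinearForm.

(** * Elimination of one variable *)
Lemma rmorph_division (A : nzRingType) (K : {rmorphism A -> A}) (v f q a t : A) :
  (v * f = q * a + t -> K v = v -> K f = f -> K a = a -> v * f = K q * a + K t)%R.
Proof.
move=> dE Kv Kf Ka; rewrite -[in LHS]Kv -[in LHS]Kf -[in RHS]Ka.
by rewrite -!rmorphM -rmorphD dE.
Qed.

Lemma poly_cofactor0 (D : idomainType) (b : D) (r a t : {poly D}) :
  (b != 0 -> b%:P * r = a * t -> (size r < size a)%N -> r = 0)%R.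
Proof.
move=> nzb e lt_ra; have [t0|nzt] := eqVneq t 0%R.
  by move/eqP: e; rewrite t0 mulr0 mulf_eq0 polyC_eq0 (negPf nzb) => /eqP.
have nza : a != 0%R by rewrite -size_poly_gt0; apply: leq_ltn_trans lt_ra.
have := congr1 (size : {poly D} -> nat) e.
rewrite mul_polyC size_scale // size_mul // => er; move: lt_ra nzt.
by rewrite er -size_poly_gt0; lia.
Qed.

Lemma size_cofactor (D : idomainType) (v : D) (g s a : {poly D}) :
  (v != 0 -> s != 0 -> (1 < size a)%N -> v%:P * g = s * a -> (size s < size g)%N)%R.
Proof.
move=> nzv nzs a_gt1 /(congr1 (size : {poly D} -> nat)).
have nza : a != 0%R by rewrite -size_poly_gt0; apply: ltnW.
rewrite mul_polyC size_scale // size_mul // => ->.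
by move: nzs a_gt1; rewrite -size_poly_gt0; lia.
Qed.

Section OneVariable.
Local Open Scope ring_scope.

Variables (k : fieldType) (n : nat) (C : {set 'I_n}) (i : 'I_n).
Hypothesis iC : i \notin C.
Local Notation R := {mpoly k[n]}.
Implicit Types (f g h a b : R) (l : 'I_n) (W : {set 'I_n}).

(** R/P_C as a ring of polynomials in x_i over the polynomials in the other variables. *)
Definition expand : R -> {poly R} :=
  mmap (polyC \o @mpolyC n k) (fun l =>
    if l \in C then 0 else if l == i then 'X else ('X_l : R)%:P).
HB.instance Definition _ := GRing.RMorphism.on expand.

Lemma expandC d : expand d%:MP = (d%:MP)%:P.
Proof. exact: mmapC. Qed.

Lemma expandX l :
  expand 'X_l = if l \in C then 0 else if l == i then 'X else ('X_l : R)%:P.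
Proof. by rewrite /expand mmapX mmap1U. Qed.

Lemma horner_expand f : (expand f).['X_i] = kill C f.
Proof.
apply: (@mpoly_rmorph_ext _ _ _ (horner_eval 'X_i \o expand) (kill C)) => [d|l] /=.
  by rewrite expandC killC /horner_eval hornerC.
rewrite expandX killX /horner_eval; case: ifP => _; first by rewrite horner0.
by case: eqP => [->|_]; rewrite ?hornerX ?hornerC.
Qed.

Lemma expand_kill f : expand (kill C f) = expand f.
Proof.
apply: (@mpoly_rmorph_ext _ _ _ (expand \o kill C) expand) => [d|l] /=.
  by rewrite killC.
rewrite killX; case: ifP => lC; last reflexivity.
by rewrite rmorph0 expandX lC.
Qed.

Lemma varprime_expand f : varprime C f <-> expand f = 0.
Proof.
split=> [kf|ef]; first by rewrite -expand_kill kf rmorph0.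
by rewrite /varprime -horner_expand ef horner0.
Qed.

Lemma expand_const f : kill (i |: C) f = f -> expand f = f%:P.
Proof.
move=> <-; apply: (@mpoly_rmorph_ext _ _ _ (expand \o kill (i |: C))
    (polyC \o kill (i |: C))) => [d|l] /=.
  by rewrite killC expandC.
rewrite killX !inE; case: (boolP (l == i)) => [_|/negPf li] /=.
  by rewrite !rmorph0.
by case: ifP => lC; [rewrite !rmorph0 | rewrite expandX lC li].
Qed.

Lemma map_expand f : map_poly (kill (i |: C)) (expand f) = expand f.
Proof.
apply: (@mpoly_rmorph_ext _ _ _ (map_poly (kill (i |: C)) \o expand)
    expand) => [d|l] /=.
  by rewrite expandC map_polyC /= killC.
rewrite expandX; case: ifP => lC; first by rewrite rmorph0.
case: ifP => li; first by rewrite map_polyX.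
by rewrite map_polyC /= killX !inE li lC.
Qed.

Lemma expand_horner (q : {poly R}) :
  expand (map_poly (kill (i |: C)) q).['X_i] = map_poly (kill (i |: C)) q.
Proof.
set p := map_poly _ _; rewrite horner_coef rmorph_sum /= -[RHS]coefK poly_def.
apply: eq_bigr => j _; rewrite rmorphM rmorphXn /= expandX (negPf iC) eqxx.
rewrite expand_const ?mul_polyC // coef_map /= kill_kill.
by rewrite setUid.
Qed.

(** Division with remainder in the variable x_i; the leading coefficient of the divisor
must be inverted, and it involves neither x_i nor the variables of C. *)
Lemma pseudo_division a f : ~ varprime C a -> exists e s r,
  let v := lead_coef (expand a) ^+ e in
  [/\ kill (i |: C) v = v, varprime C (v * f - s * a - r)
    & (size (expand r) < size (expand a))%N].
Proof.
move=> /varprime_expand/eqP nza.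
have [e [q [t [divE lt_t]]]] : exists e q t,
    lead_coef (expand a) ^+ e *: expand f = q * expand a + t /\
    (size t < size (expand a))%N.
  exists (scalp (expand f) (expand a)), (expand f %/ expand a).
  exists (expand f %% expand a).
  by rewrite ltn_modp; split=> //; apply: Pdiv.Idomain.divp_eq.
pose K : {rmorphism {poly R} -> {poly R}} := map_poly (kill (i |: C)).
exists e, (K q).['X_i], (K t).['X_i] => v.
have vE : kill (i |: C) v = v.
  by rewrite rmorphXn /= lead_coefE -coef_map map_expand.
split=> //; last first.
  rewrite expand_horner; apply: leq_ltn_trans (size_poly _ _) _.
  exact: lt_t.
apply/varprime_expand; rewrite 2!rmorphB 2!rmorphM /= !expand_horner.
rewrite (expand_const vE) mul_polyC.
have := @rmorph_division _ K v%:P (expand f) q (expand a) t.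
have Kv : K v%:P = v%:P := etrans (map_polyC _ v) (congr1 polyC vE).
rewrite mul_polyC => /(_ divE Kv (map_expand f) (map_expand a)) ->.
by rewrite -addrA -opprD subrr.
Qed.

Lemma map_expand_free W a : kill (~: (i |: W)) a = a ->
  map_poly (kill (~: W)) (expand a) = expand a.
Proof.
move=> <-; apply: (@mpoly_rmorph_ext _ _ _
    (map_poly (kill (~: W)) \o (expand \o kill (~: (i |: W))))
    (expand \o kill (~: (i |: W)))) => [d|l] /=.
  by rewrite killC expandC map_polyC /= killC.
rewrite killX !inE; case: ifPn => [_|]; first by rewrite !rmorph0.
rewrite negbK expandX => lW; case: ifP => _; first by rewrite rmorph0.
case: (l =P i) lW => [_|_ /= lW]; first by rewrite map_polyX.
by rewrite map_polyC /= killX inE lW.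
Qed.

(** Over the fraction field of k[W], a is a polynomial in x_i with invertible leading
coefficient and b is free of x_i.  Reducing g modulo a leaves a remainder r with b r
divisible by a, and the degree in x_i forces r = 0. *)
Lemma regular_pair a b (P : R -> Prop) W : i \notin W ->
  (forall f, P f -> kill (~: W) f = f -> f = 0) ->
  kill (~: (i |: W)) a = a -> kill (i |: C) b = b -> ~ varprime C a -> b <> 0 ->
  forall g h, varprime C (b * g - a * h) ->
    exists v f, ~ P v /\ varprime C (v * g - a * f).
Proof.
move=> iW PW aW bC nza nzb g h bgah.
have [e [s [r [vE vgsr lt_ra]]]] := pseudo_division g nza.
set v := _ ^+ e in vE vgsr; exists v, s.
have lcW : kill (~: W) (lead_coef (expand a)) = lead_coef (expand a).
  by rewrite lead_coefE -coef_map /= map_expand_free.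
split=> [Pv|].
  have := PW v Pv; rewrite rmorphXn /= lcW => /(_ erefl)/eqP.
  rewrite expf_eq0 lead_coef_eq0 => /andP[_ /eqP].
  by move/varprime_expand.
have Pp := varprime_is_prime k C.
have : varprime C (b * r - a * (v * h - b * s)).
  have ->: b * r - a * (v * h - b * s) =
    v * (b * g - a * h) - b * (v * g - s * a - r) by ring.
  by apply: (primeB Pp); apply: (primeM Pp).
move/varprime_expand; rewrite rmorphB !rmorphM /= expand_const // => /eqP.
rewrite subr_eq0 => /eqP e_br.
have r0 : expand r = 0.
  by apply: poly_cofactor0 e_br lt_ra; apply/eqP.
have -> : v * g - a * s = (v * g - s * a - r) + r by ring.
apply: (primeD Pp); first exact: vgsr.
by apply/varprime_expand; exact: r0.
Qed.

End OneVariable.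

(** Classical well-foundedness: S need not be decidable. *)
Lemma exists_minimal (T : Type) (S : T -> Prop) (mu : T -> nat) :
  (exists x, S x) -> exists2 x, S x & forall y, S y -> mu x <= mu y.
Proof.
case=> x0 Sx0; pose A m := `[< exists2 x, S x & mu x = m >].
have exA : exists m, A m by exists (mu x0); apply/asboolP; exists x0.
have [m /asboolP[x Sx <-] minm] := ex_minnP exA.
by exists x => // y Sy; apply: minm; apply/asboolP; exists y.
Qed.

(** * Chains of primes above a prime generated by variables *)
Section Chains.
Local Open Scope ring_scope.

Variables (k : fieldType) (n : nat).
Local Notation R := {mpoly k[n]}.
Implicit Types (f g h a b : R) (i l : 'I_n) (C W T : {set 'I_n}).
Implicit Types (P Q : R -> Prop).

(** Inverting the variables other than x_i and those of C turns R/P_C into K[x_i], where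
a nonzero prime is generated by its element of least degree and is maximal. *)
Lemma no_chain C i P Q1 Q2 : i \notin C ->
  prime_ideal P -> prime_ideal Q1 ->
  (forall f, P f -> kill (i |: C) f = f -> f = 0) ->
  (forall f, varprime C f -> Q1 f) -> (forall f, Q1 f -> Q2 f) ->
  (forall f, Q2 f -> P f) ->
  (exists2 g, Q1 g & ~ varprime C g) -> forall f, Q2 f -> Q1 f.
Proof.
move=> iC Pp Q1p PC CQ1 Q12 Q2P [g0 Q1g0 nzg0].
have Cp := varprime_is_prime k C.
(* An element a of least degree in x_i generates P up to factors outside P. *)
have [a [Pa nza] mina] := @exists_minimal _ (fun a => P a /\ ~ varprime C a)
  (fun a => size (expand C i a)) (ex_intro _ g0 (conj (Q2P _ (Q12 _ Q1g0)) nzg0)).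
have div f : P f -> exists v s, [/\ kill (i |: C) v = v, v <> 0, ~ P v &
    varprime C (v * f - s * a)].
  move=> Pf; have [e [s [r [vE fsr lt_ra]]]] := pseudo_division iC f nza.
  have nzv : lead_coef (expand C i a) ^+ e != 0.
    by rewrite expf_neq0 // lead_coef_eq0; apply/eqP => /(varprime_expand C i).
  set v := _ ^+ e in vE fsr nzv.
  exists v, s; split=> //; [exact/eqP| |].
    by move=> /PC/(_ vE)/eqP; apply/negP.
  have Cr : varprime C r.
    apply: contrapT => nzr; suff: P r.
      by move=> Pr; have := mina r (conj Pr nzr); rewrite leqNgt lt_ra.
    have -> : r = (v * f - s * a) - (v * f - s * a - r) by ring.
    apply: (primeB Pp); last exact/Q2P/Q12/CQ1.
    by apply: (primeB Pp); apply: (primeM Pp).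
  have -> : v * f - s * a = (v * f - s * a - r) + r by ring.
  exact: (primeD Cp).
have [Q1a f Q2f|nQ1a] := pselect (Q1 a).
  have [v [s [_ _ nPv /CQ1 Q1vf]]] := div f (Q2P _ Q2f).
  have : Q1 (v * f).
    rewrite -[v * f](subrK (s * a)); apply: (primeD Q1p) => //.
    exact: (primeM Q1p).
  by case/(prime_split Q1p) => // /Q12/Q2P.
(* As a is not in Q1, dividing g by a gives an element of Q1 of lower degree. *)
have [g [Q1g nzg] ming] := @exists_minimal _ (fun g => Q1 g /\ ~ varprime C g)
  (fun g => size (expand C i g)) (ex_intro _ g0 (conj Q1g0 nzg0)).
have [v [s [vE nzv nPv vgsa]]] := div g (Q2P _ (Q12 _ Q1g)).
exfalso.
have nPCv : ~ varprime C v by move=> /CQ1/Q12/Q2P.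
have nzs : ~ varprime C s.
  move=> Cs; suff: varprime C (v * g) by case/(prime_split Cp).
  rewrite -[v * g](subrK (s * a)); apply: (primeD Cp) => //.
  exact: (primeMr Cp).
have Q1s : Q1 s.
  suff: Q1 (s * a) by case/(prime_split Q1p).
  have -> : s * a = v * g - (v * g - s * a) by ring.
  by apply: (primeB Q1p); [apply: (primeM Q1p) | apply: CQ1].
have := ming s (conj Q1s nzs); rewrite leqNgt => /negP[].
move: vgsa => /(varprime_expand C i); rewrite rmorphB !rmorphM /=.
rewrite (expand_const vE) => /eqP; rewrite subr_eq0 => /eqP e_vg.
have nz f : ~ varprime C f -> expand C i f != 0.
  by move=> nf; apply/eqP => /(varprime_expand C i).
apply: size_cofactor e_vg; [exact/eqP | exact: nz |].
rewrite ltnNge; apply/negP => le1; have := size1_polyC le1.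
set d := _`_0 => ea.
have ka : kill C a = d by rewrite -(horner_expand C i) ea hornerC.
have dE : kill (i |: C) d = d by rewrite /d -coef_map map_expand.
suff /PC/(_ dE) d0 : P d by apply: nza; rewrite /varprime ka d0.
rewrite -ka -[kill C a](subKr a); apply: (primeB Pp) => //.
by apply/Q2P/Q12/CQ1/varprime_kill.
Qed.

(** Noether normalization by counting: W is a largest set of variables that are
algebraically independent modulo P, and a chain of length 2 requires two variables
beyond W. *)
Lemma regular_pair_of_chain C P Q0 Q1 Q2 :
  prime_ideal P -> prime_ideal Q1 ->
  (forall f, varprime C f -> Q0 f) ->
  (forall f, Q0 f -> Q1 f) -> ~ (forall f, Q1 f -> Q0 f) ->
  (forall f, Q1 f -> Q2 f) -> ~ (forall f, Q2 f -> Q1 f) ->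
  (forall f, Q2 f -> P f) ->
  exists a b, [/\ P a, P b, ~ varprime C a
    & forall g h, varprime C (b * g - a * h) ->
        exists v f, ~ P v /\ varprime C (v * g - a * f)].
Proof.
move=> Pp Q1p CQ0 Q01 nQ10 Q12 nQ21 Q2P.
have CP f : varprime C f -> P f by move=> /CQ0/Q01/Q12/Q2P.
have exg : exists2 g, Q1 g & ~ varprime C g.
  apply: contrapT => nog; apply: nQ10 => f Q1f; apply/CQ0.
  by apply: contrapT => nf; apply: nog; exists f.
(* The variables of W are algebraically independent modulo P. *)
pose free W := (W \subset ~: C) &&
  `[< forall f, P f -> kill (~: W) f = f -> f = 0 >].
have free0 : free set0.
  rewrite /free sub0set; apply/asboolP => f Pf; rewrite setC0 => kf.
  have fE : f = (f@_0)%:MP.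
    apply/mpolyP => m; rewrite -[in LHS]kf mcoeff_kill mcoeffC.
    rewrite -setI_eq0 setIT; case: eqVneq => [m0|nm0].
      have ->: m = 0%MM.
        apply/mnmP => l; rewrite mnm0E; apply/eqP; rewrite -leqn0 leqNgt.
        by apply/negP => ml; have := in_set0 l; rewrite -m0 inE ml.
      by rewrite eqxx mulr1.
    case: eqP => [m0|_]; last by rewrite mulr0.
    case/set0Pn: nm0 => l; by rewrite inE m0 mnm0E.
  apply: contrapT => /eqP nzf; apply: (prime_proper Pp).
  have nzc : f@_0 != 0 by apply: contra nzf => /eqP c0; rewrite fE c0 mpolyC0.
  have -> : 1 = ((f@_0)^-1)%:MP * f.
    by rewrite [in RHS]fE -mpolyCM mpolyCK mulVf // mpolyC1.
  exact: (primeM Pp).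
have [W /maxsetP[/andP[WC /asboolP PW] maxW] _] := maxset_exists free0.
have notfree i : i \notin C -> i \notin W -> exists f,
    [/\ P f, kill (~: (i |: W)) f = f & f <> 0].
  move=> iC iW; apply: contrapT => nof.
  have /maxW/(_ (subsetUr _ _)) eW : free (i |: W).
    rewrite /free subUset sub1set inE iC WC /=.
    by apply/asboolP => f Pf kf; apply: contrapT => nzf; apply: nof; exists f.
  by rewrite -eW setU11 in iW.
have [/card_gt1P[i [j [iE jE nij]]]|] := boolP (1 < #|~: C :\: W|)%N.
  move: iE jE; rewrite !inE => /andP[iW iC] /andP[jW jC].
  have [a [Pa aW nza]] := notfree i iC iW; have [b [Pb bW nzb]] := notfree j jC jW.
  have nCa : ~ varprime C a.
    rewrite /varprime -aW kill_kill.
    suff -> : C :|: ~: (i |: W) = ~: (i |: W) by rewrite aW.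
    apply/setUidPr; rewrite -setCS setCK subUset.
    by rewrite sub1set inE iC.
  exists a, b; split=> //; apply: (regular_pair iC iW PW aW) => //.
  rewrite -{1}bW kill_kill.
  suff -> : (i |: C) :|: ~: (j |: W) = ~: (j |: W) by rewrite bW.
  apply/setUidPr; rewrite -setCS setCK.
  apply/subsetP => l; rewrite !inE negb_or => /orP[/eqP->|lW].
    by rewrite eq_sym nij jC.
  have /subsetP/(_ l lW) := WC; rewrite inE => ->; rewrite andbT.
  by apply: contra iW => /eqP <-.
rewrite -leqNgt => card_le1; exfalso.
have [/eqP|[i iE]] := set_0Vmem (~: C :\: W).
  rewrite setD_eq0 => CW; have eW : ~: W = C.
    by rewrite -[RHS]setCK; congr (~: _); apply/eqP; rewrite eqEsubset WC.
  case: exg => g Q1g; apply.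
  have := PW (kill C g); rewrite eW kill_kill setUid; apply=> //.
  rewrite -[kill C g](subKr g); apply: (primeB Pp); last exact/CP/varprime_kill.
  exact/Q2P/Q12.
have [iW iC] : i \notin W /\ i \notin C by move: iE; rewrite !inE => /andP[].
have eW : ~: W = i |: C.
  have E1 : ~: C :\: W = [set i].
    by apply/eqP; rewrite eq_sym eqEcard sub1set iE cards1.
  apply/setP => l; have /setP/(_ l) := E1; rewrite !inE.
  have /subsetP/(_ l) := WC; rewrite inE.
  by case: (l \in W); case: (l \in C); case: (l == i) => //= /(_ isT).
apply: nQ21; apply: (no_chain iC Pp Q1p) => //; first by rewrite -eW.
by move=> f /CQ0/Q01.
Qed.

End Chains.

(** * Ideals that are intersections of primes generated by variables *)
Section SquarefreeIdeal.
Local Open Scope ring_scope.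

Variables (k : fieldType) (n : nat) (CC : {set {set 'I_n}}).
Local Notation R := {mpoly k[n]}.
Implicit Types (f g h a b : R) (i : 'I_n) (C D : {set 'I_n}) (P Q : R -> Prop).

Definition vars_in P : {set 'I_n} := [set i | `[< P 'X_i >]].

Lemma vars_inP P i : i \in vars_in P <-> P 'X_i.
Proof. by rewrite inE; split=> [/asboolP|/asboolP]. Qed.

Lemma varprime_vars_in P C f : prime_ideal P -> C \subset vars_in P ->
  varprime C f -> P f.
Proof.
move=> Pp CP; apply: varprime_sub => // i iC.
exact/vars_inP/(subsetP CP).
Qed.

Variable I : R -> Prop.
Hypothesis IE : forall f, I f <-> forall C, C \in CC -> varprime C f.

Let outside P : R := \prod_(i | i \notin vars_in P) 'X_i.

Let outside_notin P : prime_ideal P -> ~ P (outside P).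
Proof. by move=> Pp; apply: prime_prod => // i /negP + /vars_inP. Qed.

Let varprime_outside P C : ~~ (C \subset vars_in P) -> varprime C (outside P).
Proof.
case/subsetPn => i iC iP; rewrite /outside (bigD1 i) //=.
by apply: (primeMr (varprime_is_prime k C)); apply/varprimeX.
Qed.

(** A component not through P is removed by the product of the variables outside P. *)
Lemma sat_varinter P f : prime_ideal P -> sat I P f <-> varinter CC (vars_in P) f.
Proof.
move=> Pp; split=> [[u nPu /IE Iuf] C CCC CP|Cf].
  case/(prime_split (varprime_is_prime k C)): (Iuf C CCC) => //.
  by move/(varprime_vars_in Pp CP).
exists (outside P); first exact: outside_notin.
apply/IE => C CCC; have [CP|nCP] := boolP (C \subset vars_in P).
  exact/(primeM (varprime_is_prime k C))/Cf.
exact/(primeMr (varprime_is_prime k C))/varprime_outside.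
Qed.

Lemma prime_over P : prime_ideal P -> (forall f, I f -> P f) ->
  exists2 C, C \in CC & C \subset vars_in P.
Proof.
move=> Pp IP; apply: contrapT => noC.
apply: (outside_notin Pp); apply/IP/IE => C CCC; apply: varprime_outside.
by apply/negP => CP; apply: noC; exists C.
Qed.

End SquarefreeIdeal.

(** * Connectedness in codimension one implies (S_2) *)
Section SerreSufficient.
Local Open Scope ring_scope.

Variables (k : fieldType) (n : nat) (CC : {set {set 'I_n}}) (c : nat).
Local Notation R := {mpoly k[n]}.
Implicit Types (f g h a b : R) (i : 'I_n) (C D : {set 'I_n}) (P Q : R -> Prop).

Variable I : R -> Prop.
Hypothesis IE : forall f, I f <-> forall C, C \in CC -> varprime C f.
Hypothesis cardCC : forall C, C \in CC -> #|C| = c.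
Hypothesis CCconn : locally_connected CC c.

(** Modulo P_C the sum of the variables of i |: C is x_i, so together they generate the
prime of i |: C. *)
Lemma varprime_setU1 C i g : i \notin C -> varprime (i |: C) g ->
  exists f, varprime C (g - varsum k (i |: C) * f).
Proof.
move=> iC kg; have [q] := kill_sub (i |: C) g; rewrite kg subr0 => gE.
have killE : kill C (varsum k (i |: C)) = 'X_i.
  by rewrite kill_varsum setDUl setDv setU0 (setDidPl _) ?big_set1 // disjoints1.
exists (q i); rewrite /varprime rmorphB rmorphM /= killE gE rmorph_sum big_setU1 //=.
rewrite big1 => [|l lC]; last by rewrite rmorphM /= killX lC mulr0.
by rewrite rmorphM /= killX (negPf iC) addr0 mulrC subrr.
Qed.

Lemma serre_sufficient P : prime_ideal P -> (forall f, I f -> P f) ->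
  (has_chain I P 1 -> has_depth1 I P) /\ (has_chain I P 2 -> has_depth2 I P).
Proof.
move=> Pp IP; set T := vars_in P.
have [C0 CC0 C0T] := prime_over IE Pp IP.
have le_cT : (c <= #|T|)%N by rewrite -(cardCC CC0) subset_leq_card.
have under Q : prime_ideal Q -> (forall f, I f -> Q f) ->
    (forall f, Q f -> P f) ->
    exists C, [/\ C \in CC, C \subset T & forall f, varprime C f -> Q f].
  move=> Qp IQ QP; have [C CCC CQ] := prime_over IE Qp IQ.
  exists C; split=> // [|f]; last exact: varprime_vars_in.
  apply: subset_trans CQ _; apply/subsetP => i.
  by move=> /vars_inP/QP/vars_inP.
have satE f : sat I P f <-> varinter CC T f by apply: sat_varinter.
have PT f : varprime T f -> P f by apply: varprime_vars_in.
have sum_in : P (varsum k T) by apply: prime_sum => // i /vars_inP.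
have sum_out D : (#|D| < #|T|)%N -> ~ varprime D (varsum k T).
  by move=> lt_DT; apply: varsum_notin => /subset_leq_card; lia.
have sum_reg : (c < #|T|)%N -> forall x, sat I P (varsum k T * x) -> sat I P x.
  move=> lt_cT x /satE Isx; apply/satE => C CCC CT.
  case/(prime_split (varprime_is_prime k C)): (Isx C CCC CT) => //.
  by move/sum_out; rewrite (cardCC CCC) lt_cT => /(_ isT).
have minE C : #|T| = c -> C \in CC -> C \subset T -> C = T.
  by move=> cT CCC CT; apply/eqP; rewrite eqEcard CT (cardCC CCC) cT leqnn.
have min_satE f : #|T| = c -> sat I P f <-> varprime T f.
  move=> cT; rewrite satE; split=> [|Tf C CCC CT]; last by rewrite (minE C).
  by move/(_ C0 CC0 C0T); rewrite (minE C0).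
have Tp := varprime_is_prime k T.
split=> [[Q [Qp Qc]]|[Q [Qp Qc]]].
  have [lt_cT|] := ltnP c #|T|; first by exists (varsum k T) => //; apply: sum_reg.
  move=> le_Tc; have cT : #|T| = c by apply/eqP; rewrite eqn_leq le_Tc.
  have [Q0p IQ0 Q0P] := Qp ord0.
  have [Q1p IQ1 Q1P] := Qp (lift ord0 ord0).
  have [Q01 nQ10] := Qc ord0 (lift ord0 ord0) isT.
  have [C [CCC CT CQ0]] := under _ Q0p IQ0 Q0P.
  have eCT := minE C cT CCC CT; rewrite eCT in CQ0.
  have [a Q1a nTa] : exists2 a, Q (lift ord0 ord0) a & ~ varprime T a.
    apply: contrapT => noa; apply: nQ10 => x Q1x; apply/CQ0.
    by apply: contrapT => nTx; apply: noa; exists x.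
  exists a; first exact: Q1P.
  by move=> x /(min_satE _ cT)/(prime_split Tp)[//|Tx]; apply/min_satE.
have [Q0p IQ0 Q0P] := Qp ord0.
have [Q1p IQ1 Q1P] := Qp (lift ord0 ord0).
have [Q2p IQ2 Q2P] := Qp (lift ord0 (lift ord0 ord0)).
have [Q01 nQ10] := Qc ord0 (lift ord0 ord0) isT.
have [Q12 nQ21] := Qc (lift ord0 ord0) (lift ord0 (lift ord0 ord0)) isT.
have [C [CCC CT CQ0]] := under _ Q0p IQ0 Q0P.
(* If #|T| = c, then R/I is the polynomial ring R/P_T near P. *)
have [lt_cT|le_Tc] := ltnP c #|T|; last first.
  have cT : #|T| = c by apply/eqP; rewrite eqn_leq le_Tc.
  have eCT := minE C cT CCC CT; rewrite eCT in CQ0.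
  have [a [b [Pa Pb nTa reg]]] :=
    regular_pair_of_chain Pp Q1p CQ0 Q01 nQ10 Q12 nQ21 Q2P.
  exists a, b; split=> // [x /(min_satE _ cT)/(prime_split Tp)[//|Tx]|g h].
    exact/min_satE.
  move=> /(min_satE _ cT)/reg[v [f [nPv Tvf]]].
  by exists v, f; split=> //; apply/min_satE.
(* With a = [varsum], only b remains to be chosen. *)
suff [b [Pb reg_b ab]] : exists b, [/\ P b,
    forall C, C \in CC -> C \subset T -> forall g h,
      varprime C (b * g - varsum k T * h) -> exists f, varprime C (g - varsum k T * f)
  & forall D, D \subset T -> (#|D| <= c.+1)%N ->
      ~ varprime D (varsum k T) \/ ~ varprime D b].
  exists (varsum k T), b; split=> //; first exact: sum_reg.
  move=> g h /satE Ibgah; have [|f If] := glue_regular CCconn _ reg_b ab Ibgah.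
    by move=> D CCD DT; apply: sum_out; rewrite cardCC.
  by exists 1, f; rewrite mul1r; split; [exact: prime_proper | apply/satE].
have [cT|] := eqVneq #|T| c.+1; last first.
  move=> neT; have lt_ScT : (c.+1 < #|T|)%N by rewrite ltn_neqAle eq_sym neT.
  exists (varcop k T); split.
  - by apply: varcop_in => // i /vars_inP.
  - move=> D CCD DT g h; apply: varsum_varcop_regular => //.
    by rewrite (cardCC CCD).
  - by move=> D _ leD; left; apply: sum_out; lia.
have TE D : D \in CC -> D \subset T -> exists2 i, i \notin D & T = i |: D.
  move=> CCD DT; have /cards1P[i iE] : #|T :\: D| == 1%N.
    by rewrite cardsDS // cT (cardCC CCD) subSnn.
  have : i \in T :\: D by rewrite iE inE.
  rewrite inE => /andP[iD iT]; exists i => //.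
  by rewrite -iE -[LHS](setID _ D) (setIidPr DT) setUC.
(* P_T has height 1 over P_C, so P = P_T leaves no room for the chain. *)
have [Psub|] := pselect (forall f, P f -> varprime T f).
  exfalso; apply: nQ21; have [i iC eT] := TE C CCC CT.
  apply: (no_chain iC Pp Q1p) => // [f /Psub|f /CQ0/Q01//|].
    by rewrite /varprime eT => -> .
  apply: contrapT => nog; apply: nQ10 => f Q1f; apply/CQ0.
  by apply: contrapT => nf; apply: nog; exists f.
move=> notsub; have [b Pb nTb] : exists2 b, P b & ~ varprime T b.
  apply: contrapT => nob; apply: notsub => f Pf.
  by apply: contrapT => nf; apply: nob; exists f.
exists b; split=> // [D CCD DT g h bgah|D DT _]; last first.
  by right=> /(varprimeS DT).
have [i iD eT] := TE D CCD DT.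
rewrite eT; apply: varprime_setU1 => //; rewrite -eT.
have : varprime T (b * g).
  rewrite -[b * g](subrK (varsum k T * h)); apply: (primeD Tp).
    exact: varprimeS bgah.
  apply: (primeMr Tp); rewrite /varprime kill_varsum setDv.
  by rewrite big1 // => j; rewrite inE.
by case/(prime_split Tp).
Qed.

End SerreSufficient.

(** * Connectedness is necessary for depth at least two *)
Section Connectedness.
Local Open Scope ring_scope.

Variables (k : fieldType) (n : nat) (CC : {set {set 'I_n}}).
Local Notation R := {mpoly k[n]}.
Implicit Types (f g h a b : R) (i : 'I_n) (C D U X Y : {set 'I_n}).

Variable I : R -> Prop.
Hypothesis IE : forall f, I f <-> forall C, C \in CC -> varprime C f.

Lemma vars_in_varprime U : vars_in (varprime (k := k) U) = U.
Proof.
apply/setP => i; apply/idP/idP => [/vars_inP/varprimeX //|iU].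
exact/vars_inP/varprimeX.
Qed.

(** The components inside U contain X or Y, so P_X and P_Y multiply to zero while
P_X + P_Y = P_U.  For a, b in P_U with P_X-parts aX, bX, the identity
b aX = a bX holds near P_U.  If a, b were regular, then v aX = a f with v outside P_U:
here f / v is the function that is 1 on the components containing Y and 0 on the
others.  Multiplying by variables of Y and X puts f and v - f into P_U. *)
Lemma not_depth2_of_split U X Y C1 C2 : X :|: Y = U ->
  (forall C, C \in CC -> C \subset U -> X \subset C \/ Y \subset C) ->
  C1 \in CC -> C1 \subset U -> ~~ (X \subset C1) ->
  C2 \in CC -> C2 \subset U -> ~~ (Y \subset C2) ->
  ~ has_depth2 I (varprime U).
Proof.
move=> UE XY CC1 C1U /subsetPn[i iX iC1] CC2 C2U /subsetPn[j jY jC2].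
have Up := varprime_is_prime k U.
have satE f : sat I (varprime U) f <-> varinter CC U f.
  by rewrite (sat_varinter IE) // vars_in_varprime.
have satXY f g : varprime X f -> varprime Y g -> sat I (varprime U) (f * g).
  move=> Xf Yg; apply/satE => C CCC CU; have Cp := varprime_is_prime k C.
  case: (XY C CCC CU) => [XC|YC].
    exact/(primeMr Cp)/(varprimeS XC).
  exact/(primeM Cp)/(varprimeS YC).
have satD f g : sat I (varprime U) f -> sat I (varprime U) g ->
    sat I (varprime U) (f + g).
  move=> /satE If /satE Ig; apply/satE => C CCC CU.
  by apply: (primeD (varprime_is_prime k C)); [apply: If | apply: Ig].
have satM f g : sat I (varprime U) g -> sat I (varprime U) (f * g).
  move=> /satE Ig; apply/satE => C CCC CU.
  exact/(primeM (varprime_is_prime k C))/Ig.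
have killX_Y f : varprime U f -> varprime Y (kill X f).
  by rewrite /varprime kill_kill setUC UE.
case=> a [b [Ua Ub reg_a reg_b]].
pose aX := a - kill X a; pose bX := b - kill X b.
have XaX : varprime X aX by apply: varprime_kill.
have XbX : varprime X bX by apply: varprime_kill.
have [v [f [nUv satvf]]] : exists v f,
    ~ varprime U v /\ sat I (varprime U) (v * aX - a * f).
  apply: (reg_b aX bX).
  have -> : b * aX - a * bX = aX * kill X b + -1 * (bX * kill X a).
    by rewrite /aX /bX; ring.
  by apply: satD; [|apply: satM]; apply: satXY => //; apply: killX_Y.
have cancel_var D l x : D \in CC -> D \subset U -> l \notin D ->
    sat I (varprime U) (a * (x * 'X_l)) -> varprime U x.
  move=> CCD DU lD /reg_a/satE/(_ D CCD DU)/(prime_split (varprime_is_prime k D)).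
  by case=> [/(varprimeS DU)//|/varprimeX]; rewrite (negPf lD).
apply: nUv; rewrite -[v](subrK f); apply: (primeD Up).
  apply: (cancel_var C1 i) => //.
  have -> : a * ((v - f) * 'X_i) =
      'X_i * (v * aX - a * f) + v * ('X_i * kill X a) by rewrite /aX; ring.
  apply: satD; apply: satM => //; apply: satXY; first exact/varprimeX.
  exact: killX_Y.
apply: (cancel_var C2 j) => //.
have -> : a * (f * 'X_j) = v * (aX * 'X_j) + (- 'X_j) * (v * aX - a * f) by ring.
apply: satD; apply: satM => //; apply: satXY => //.
exact/varprimeX.
Qed.

Lemma has_chain2 U C : C \in CC -> C \subset U -> (1 < #|U :\: C|)%N ->
  has_chain I (varprime U) 2.
Proof.
move=> CCC CU /card_gt1P[i [j [iUC jUC nij]]].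
pose s (m : nat) := if m == 0%N then C else if m == 1%N then i |: C else
  [set i; j] :|: C.
have s_inc (l m : nat) : (l < m < 3)%N -> s l \subset s m.
  case: m => [|[|[|m]]]; rewrite ?andbF //; case: l => [|[|l]] //= _;
    rewrite ?subsetUr // setSU //.
  by apply/subsetP => x; rewrite !inE => ->.
have s_out (l m : nat) : (l < m < 3)%N -> exists2 x, x \in s m & x \notin s l.
  move: iUC jUC; rewrite !inE => /andP[iC iU] /andP[jC jU].
  case: m => [|[|[|m]]]; rewrite ?andbF //; case: l => [|[|l]] //= _.
  - by exists i; rewrite ?inE ?eqxx.
  - by exists i; rewrite ?inE ?eqxx.
  - by exists j; rewrite ?inE ?eqxx ?orbT // negb_or eq_sym nij.
have s2U : s 2%N \subset U.
  rewrite /s /= !subUset !sub1set CU andbT.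
  by move: iUC jUC; rewrite !inE => /andP[_ ->] /andP[_ ->].
exists (fun m : 'I_3 => varprime (s m)); split=> [m|l m lt_lm].
  split=> [|x Ix|x].
  - exact: varprime_is_prime.
  - move/IE/(_ C CCC): Ix; apply: varprimeS.
    by case: m => -[|m] //= lt_m3; apply: (s_inc 0%N).
  - apply: varprimeS; apply: subset_trans s2U.
    by case: m => -[|[|[|//]]] //= _; apply: s_inc.
have lm3 : (l < m < 3)%N by rewrite lt_lm ltn_ord.
split=> [x|sub]; first by apply: varprimeS; apply: s_inc.
have [x xm xl] := s_out _ _ lm3.
have /sub/varprimeX : varprime (s m) ('X_x : R) by apply/varprimeX.
by rewrite (negPf xl).
Qed.

End Connectedness.

(** * Complementary edge ideals *)
Section EdgeIdeal.
Local Open Scope ring_scope.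

Variables (k : fieldType) (n : nat) (G : sgraph 'I_n).
Local Notation R := {mpoly k[n]}.
Implicit Types (f : R) (e C N : {set 'I_n}).

(** The nonfaces of the complex whose facets are the edges of G.  That complex is the
Alexander dual of the Stanley-Reisner complex of I_c(G). *)
Definition nonfaces : {set {set 'I_n}} :=
  [set N : {set 'I_n} | [forall e in edges G, ~~ (N \subset e)]].

Lemma nonfacesP N :
  reflect (forall u v, adj G u v -> ~~ (N \subset [set u; v])) (N \in nonfaces).
Proof.
rewrite inE; apply: (iffP forall_inP) => [NN u v uv|NN e].
  apply: NN; rewrite inE; apply/existsP; exists u; apply/existsP; exists v.
  by rewrite uv /=.
by rewrite inE => /existsP[u /existsP[v /andP[uv /eqP->]]]; apply: NN.
Qed.

Lemma nonfacesS C N : C \subset N -> C \in nonfaces -> N \in nonfaces.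
Proof.
move=> CN /nonfacesP CC; apply/nonfacesP => u v uv.
by apply: contra (CC u v uv); apply: subset_trans.
Qed.

Lemma mem_ideal_gen (A : comNzRingType) (s : seq A) x :
  x \in s -> x \in ideal_gen s.
Proof.
move=> xs; have lt_i : (index x s < size s)%N by rewrite index_mem.
apply/asboolP; exists (fun j => (j == index x s)%:R).
rewrite (bigD1 (Ordinal lt_i)) //= eqxx mul1r nth_index // big1 ?addr0 //.
by move=> j; rewrite -val_eqE /= => /negPf->; rewrite mul0r.
Qed.

Lemma sqfree_monomial_dvd e (m : 'X_{1..n}) : e \subset mvars m ->
  exists f, 'X_[m] = f * sqfree_monomial k e.
Proof.
move=> em.
exists (\prod_(i in e) 'X_i ^+ (m i).-1 * \prod_(i | i \notin e) 'X_i ^+ m i).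
rewrite mpolyXE_id (bigID (mem e)) /= mulrAC; congr (_ * _).
rewrite -big_split /=; apply: eq_bigr => i ie.
have : i \in mvars m by apply: (subsetP em).
by rewrite inE; case: (m i) => // j _; rewrite exprSr.
Qed.

Lemma mem_comp_edge_idealP (n_gt2 : (2 < n)%N) f :
  f \in comp_edge_ideal k G n_gt2 <-> forall N, N \in nonfaces -> varprime N f.
Proof.
split=> [/asboolP[c ->] N /nonfacesP NN|Nf].
  have Np := varprime_is_prime k N.
  apply: (prime_sum Np) => i _; apply: (primeM Np).
  have : (comp_edge_gens k G)`_i \in comp_edge_gens k G by rewrite mem_nth.
  case/mapP => e; rewrite mem_enum inE => /existsP[u /existsP[v /andP[uv /eqP->]]] ->.
  have /subsetPn[x xN xuv] := NN u v uv.
  rewrite /sqfree_monomial (bigD1 x) ?inE //=.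
    by apply: (primeMr Np); apply/varprimeX.
  by rewrite in_set2 in xuv.
rewrite (mpolyE f) big_seq; apply: rpred_sum => m mf.
rewrite -mul_mpolyC; apply: idealMr.
have [e eG me] : exists2 e, e \in edges G & ~: e \subset mvars m.
  have : ~: mvars m \notin nonfaces.
    apply/negP => /Nf/varprimeP/(_ m mf).
    by rewrite -setI_eq0 setICr eqxx.
  rewrite inE => /forall_inPn[e eG]; rewrite negbK => me; exists e => //.
  by rewrite -setCS setCK.
have [g ->] := sqfree_monomial_dvd me; apply: idealMr.
by apply: mem_ideal_gen; apply: map_f; rewrite mem_enum.
Qed.

Lemma comp_edge_ideal_generated (n_gt2 : (2 < n)%N) (CC : {set {set 'I_n}}) :
  (forall C, C \in CC -> C \in nonfaces) ->
  (forall N, N \in nonfaces -> exists2 C, C \in CC & C \subset N) ->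
  forall f, f \in comp_edge_ideal k G n_gt2 <-> forall C, C \in CC -> varprime C f.
Proof.
move=> CCN NCC f; rewrite mem_comp_edge_idealP; split=> [Nf C /CCN/Nf //|Cf N].
by case/NCC => C /Cf Cf' CN; apply: varprimeS Cf'.
Qed.

Lemma serre2_of_connected (n_gt2 : (2 < n)%N) (CC : {set {set 'I_n}}) c :
  (forall C, C \in CC -> C \in nonfaces) ->
  (forall N, N \in nonfaces -> exists2 C, C \in CC & C \subset N) ->
  (forall C, C \in CC -> #|C| = c) -> locally_connected CC c ->
  serre_condition 2 {ideal_quot (comp_edge_ideal k G n_gt2)}.
Proof.
move=> CCN NCC cardCC CCconn; apply/serre2P => P Pp IP.
have IE := comp_edge_ideal_generated n_gt2 CCN NCC.
exact: serre_sufficient IE cardCC CCconn P Pp IP.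
Qed.

(** A disconnecting splitting at P_U bounds the dimension there by 1; a component C2
through P_U contributes dimension #|U :\: C2|. *)
Lemma serre2_split (n_gt2 : (2 < n)%N) (U X Y C1 C2 : {set 'I_n}) :
  serre_condition 2 {ideal_quot (comp_edge_ideal k G n_gt2)} ->
  X :|: Y = U ->
  (forall C, C \in nonfaces -> C \subset U -> X \subset C \/ Y \subset C) ->
  C1 \in nonfaces -> C1 \subset U -> ~~ (X \subset C1) ->
  C2 \in nonfaces -> C2 \subset U -> ~~ (Y \subset C2) ->
  (#|U :\: C2| <= 1)%N.
Proof.
move=> /serre2P S2 UE XY NC1 C1U XC1 NC2 C2U YC2; rewrite leqNgt; apply/negP => gt1.
have IE := mem_comp_edge_idealP n_gt2.
have IP f : f \in comp_edge_ideal k G n_gt2 -> varprime U f.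
  by move/IE/(_ C2 NC2); apply: varprimeS.
have [_ d2] := S2 _ (varprime_is_prime k U) IP.
apply: (not_depth2_of_split IE UE XY NC1 C1U XC1 NC2 C2U YC2).
exact: d2 (has_chain2 IE NC2 C2U gt1).
Qed.

End EdgeIdeal.

(** * Nonfaces of a graph *)
Section Graph.
Variables (n : nat) (G : sgraph 'I_n).
Implicit Types (u v w a b : 'I_n) (C N : {set 'I_n}).
Local Notation nonfaces := (nonfaces G).

Lemma adjC u v : adj G u v = adj G v u. Proof. exact: adj_sym. Qed.

Lemma adj_neq u v : adj G u v -> u != v.
Proof. by apply: contraTneq => ->; rewrite adj_irrefl. Qed.

Lemma nonisolatedP v : ~ isolated G v -> exists u, adj G v u.
Proof.
move=> niso; apply: contrapT => nou; apply: niso => u.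
by apply/negP => vu; apply: nou; exists u.
Qed.

Lemma nonadj_nonface u v : u != v -> ~~ adj G u v -> [set u; v] \in nonfaces.
Proof.
move=> nuv nadj; apply/nonfacesP => x y xy; apply: contra nadj.
rewrite subUset !sub1set !in_set2.
case/andP => /orP[]/eqP eu /orP[]/eqP ev; move: nuv; rewrite eu ev ?eqxx //.
by rewrite adjC.
Qed.

Lemma isolated_nonface v : isolated G v -> [set v] \in nonfaces.
Proof.
move=> iso_v; apply/nonfacesP => x y xy; apply/negP.
rewrite sub1set in_set2 => /orP[]/eqP e.
  by have := iso_v y; rewrite e xy.
by have := iso_v x; rewrite e adjC xy.
Qed.

Lemma adj_not_nonface u v N : adj G u v -> N \subset [set u; v] -> N \notin nonfaces.
Proof. by move=> uv Nuv; apply/negP => /nonfacesP/(_ u v uv); rewrite Nuv. Qed.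

Lemma cards3 u v w : u != v -> u != w -> v != w -> #|[set u; v; w]| = 3.
Proof.
move=> uv uw vw; rewrite setUC cardsU1 cards2 uv in_set2.
by rewrite eq_sym (negPf uw) eq_sym (negPf vw).
Qed.

Lemma single_not_nonface v : ~ isolated G v -> [set v] \notin nonfaces.
Proof.
case/nonisolatedP => u vu; apply: (adj_not_nonface vu).
by rewrite sub1set in_set2 eqxx.
Qed.

Lemma triple_nonface u v w : u != v -> u != w -> v != w -> [set u; v; w] \in nonfaces.
Proof.
move=> uv uw vw; apply/nonfacesP => x y xy; apply/negP => /subset_leq_card.
by rewrite cards3 // cards2; case: (_ != _).
Qed.

Lemma triangle_neq u v w : adj G u v -> adj G v w -> adj G w u ->
  [/\ u != v, u != w & v != w].
Proof. by move=> /adj_neq uv /adj_neq vw /adj_neq; rewrite eq_sym. Qed.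

Lemma triangle_card u v w : adj G u v -> adj G v w -> adj G w u ->
  #|[set u; v; w]| = 3.
Proof. by move=> uv vw wu; have [] := triangle_neq uv vw wu; apply: cards3. Qed.

Lemma triangle_nonface u v w : adj G u v -> adj G v w -> adj G w u ->
  [set u; v; w] \in nonfaces.
Proof.
by move=> uv vw wu; have [] := triangle_neq uv vw wu; apply: triple_nonface.
Qed.

End Graph.

(** * Graphs for which (S_2) holds *)
Section Necessary.
Variables (k : fieldType) (n : nat) (G : sgraph 'I_n) (n_gt2 : 2 < n).
Hypothesis S2 : serre_condition 2 {ideal_quot (comp_edge_ideal k G n_gt2)}.
Implicit Types (u v w a b : 'I_n) (C N : {set 'I_n}).
Local Notation nonfaces := (nonfaces G).

(** Apply [serre2_split] with X = [set a] and Y = C: by minimality, C is the only nonface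
in a |: C that avoids a. *)
Lemma cone_small a C N : a \notin C -> C \in nonfaces ->
  (forall x, x \in C -> C :\ x \notin nonfaces) ->
  N \in nonfaces -> N \subset a |: C -> ~~ (C \subset N) ->
  #|(a |: C) :\: N| <= 1.
Proof.
move=> aC NC minC NN NaC CN.
apply: (serre2_split S2 (X := [set a]) (Y := C) (C1 := C)) => //.
- move=> D ND DaC; have [aD|aD] := boolP (a \in D); first by left; rewrite sub1set.
  right; apply/negPn/negP => /subsetPn[x xC xD].
  move/negP: (minC x xC); apply; apply: nonfacesS ND.
  apply/subsetP => y yD; have := subsetP DaC y yD; rewrite !inE.
  case: eqP => [ya|_ /= ->]; first by rewrite -ya yD in aD.
  by rewrite andbT; apply: contraNneq xD => <-.
- exact: subsetUr.
- by rewrite sub1set.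
Qed.

(** A component of codimension 1 and one of codimension 2 cannot coexist. *)
Lemma isolated_no_pair v u w : isolated G v -> ~ isolated G u -> ~ isolated G w ->
  u != w -> adj G u w.
Proof.
move=> iso_v niso_u niso_w nuw; apply/negPn/negP => nadj.
have vu : v != u by apply/eqP => e; apply: niso_u; rewrite -e.
have vw : v != w by apply/eqP => e; apply: niso_w; rewrite -e.
have vuw : v \notin [set u; w] by rewrite !inE negb_or vu.
suff : #|(v |: [set u; w]) :\ v| <= 1 by rewrite setU1K // cards2 nuw.
apply: (cone_small vuw (nonadj_nonface nuw nadj) _ (isolated_nonface iso_v)).
- move=> x; rewrite in_set2 => /orP[]/eqP->.
    by rewrite setU1K ?in_set1 //; apply: single_not_nonface.
  rewrite setUC setU1K ?in_set1 1?eq_sym //.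
  exact: single_not_nonface.
- exact: subsetUl.
- by rewrite subUset !sub1set !in_set1 eq_sym (negPf vu).
Qed.


Lemma triangle_minimal u v w x : adj G u v -> adj G v w -> adj G w u ->
  x \in [set u; v; w] -> [set u; v; w] :\ x \notin nonfaces.
Proof.
move=> uv vw wu xT; have : [|| x == u, x == v | x == w].
  by move: xT; rewrite !inE -orbA.
case/or3P => /eqP->.
- apply: (adj_not_nonface vw); apply/subsetP => y; rewrite !inE.
  by case: (y == u); case: (y == v).
- apply: (adj_not_nonface wu); apply/subsetP => y; rewrite !inE.
  by case: (y == u); case: (y == v); case: (y == w).
- apply: (adj_not_nonface uv); apply/subsetP => y; rewrite !inE.
  by case: (y == u); case: (y == v); case: (y == w).
Qed.

(** A component of codimension 1 and one of codimension 3 cannot coexist. *)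
Lemma isolated_no_triangle v a b c : isolated G v ->
  adj G a b -> adj G b c -> ~~ adj G c a.
Proof.
move=> iso_v ab bc; apply/negP => ca.
have nv x y : adj G x y -> x != v.
  by move=> xy; apply/eqP => e; have := iso_v y; rewrite -e xy.
have vT : v \notin [set a; b; c].
  by rewrite !inE !negb_or !(eq_sym v) (nv a b) // (nv b c) // (nv c a).
have T3 := triangle_card ab bc ca.
suff : #|(v |: [set a; b; c]) :\ v| <= 1 by rewrite setU1K // T3.
have Tmin x := triangle_minimal ab bc ca (x := x).
apply: (cone_small vT _ Tmin (isolated_nonface iso_v)).
- exact: triangle_nonface.
- exact: subsetUl.
- by apply/negP => /subset_leq_card; rewrite T3 cards1.
Qed.

(** Otherwise the triangle and the pair a, u are components of codimension 3 and 2 that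
meet in codimension 4, and they separate the components inside the four vertices. *)
Lemma triangle_dominates u v w a : adj G u v -> adj G v w -> adj G w u ->
  a \notin [set u; v; w] -> adj G a u.
Proof.
move=> uv vw wu aT; apply/negPn/negP => nau.
have T3 := triangle_card uv vw wu.
have au : a != u by apply: contraNneq aT => ->; rewrite !inE eqxx.
have := @cone_small a [set u; v; w] [set a; u] aT.
rewrite cardsDS; last by rewrite setUS // -setUA subsetUl.
rewrite cardsU1 aT T3 cards2 au => small; suff : 4 - 2 <= 1 by [].
apply: small => [|x|||].
- exact: triangle_nonface.
- exact: triangle_minimal.
- exact: nonadj_nonface.
- by rewrite setUS // -setUA subsetUl.
- by apply/negP => /subset_leq_card; rewrite T3 cards2 au.
Qed.

(** Each vertex off a triangle sees all of it and thus lies on a triangle with any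
two of its vertices; a second vertex off the triangle sees this new triangle too. *)
Lemma triangle_complete u v w : adj G u v -> adj G v w -> adj G w u ->
  is_complete G.
Proof.
move=> uv vw wu p q npq.
have dom x y z a : adj G x y -> adj G y z -> adj G z x -> a \notin [set x; y; z] ->
    [/\ adj G a x, adj G a y & adj G a z].
  move=> xy yz zx aT; split; first exact: (triangle_dominates xy yz zx).
    apply: (triangle_dominates yz zx xy); apply: contra aT.
    by rewrite !inE; case: (a == x); case: (a == y); case: (a == z).
  apply: (triangle_dominates zx xy yz); apply: contra aT.
  by rewrite !inE; case: (a == x); case: (a == y); case: (a == z).
have sub x a : x \in [set u; v; w] -> a != x -> adj G a x.
  move=> xT nax; have [aT|aT] := boolP (a \in [set u; v; w]); last first.
    have [au av aw] := dom u v w a uv vw wu aT.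
    by move: xT; rewrite !inE -orbA => /or3P[]/eqP->.
  move: aT xT nax; rewrite !inE -!orbA => /or3P[]/eqP-> /or3P[]/eqP->;
    by rewrite ?eqxx // 1?adjC.
have [pT|pT] := boolP (p \in [set u; v; w]).
  by rewrite adjC; apply: sub; rewrite 1?eq_sym //.
have [qT|qT] := boolP (q \in [set u; v; w]); first exact: sub.
have [pu pv pw] := dom u v w p uv vw wu pT.
have [qu qv qw] := dom u v w q uv vw wu qT.
have vp : adj G v p by rewrite adjC.
have qpuv : q \notin [set p; u; v].
  by rewrite !inE !negb_or eq_sym npq (adj_neq qu) (adj_neq qv).
by have [qp _ _] := dom p u v q pu uv vp qpuv; rewrite adjC.
Qed.

(** The pairs a, b and c, d are the only components inside the four vertices, and they
meet in codimension 4. *)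
Lemma no_square a b c d : a != b -> c != d -> ~~ adj G a b -> ~~ adj G c d ->
  adj G a c -> adj G c b -> adj G b d -> ~~ adj G d a.
Proof.
move=> nab ncd nadj_ab nadj_cd ac cb bd; apply/negP => da.
have bc : adj G b c by rewrite adjC.
have ad : adj G a d by rewrite adjC.
have nab_cd x : x \in [set a; b] -> x \notin [set c; d].
  rewrite !in_set2 negb_or => /orP[]/eqP->.
    by rewrite (adj_neq ac) (adj_neq ad).
  by rewrite (adj_neq bc) (adj_neq bd).
suff : #|([set a; b] :|: [set c; d]) :\: [set a; b]| <= 1.
  rewrite setDUl setDv set0U (setDidPl _) ?cards2 ?ncd //.
  by rewrite disjoint_sym disjoint_subset; apply/subsetP => x /nab_cd.
apply: (serre2_split S2 (C1 := [set c; d]) erefl).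
- move=> N NN Nabcd; apply: contrapT => noXY.
  have [x xab xN] : exists2 x, x \in [set a; b] & x \notin N.
    by apply/subsetPn/negP => sub; apply: noXY; left.
  have [y ycd yN] : exists2 y, y \in [set c; d] & y \notin N.
    by apply/subsetPn/negP => sub; apply: noXY; right.
  have drop p p' q q' : adj G p' q' -> N \subset [set p; p'] :|: [set q; q'] ->
      p \notin N -> q \notin N -> False.
    move=> pq' sub pN qN; suff : N \notin nonfaces by rewrite NN.
    apply: (adj_not_nonface pq').
    apply/subsetP => z zN; have := subsetP sub z zN.
    have zp : z != p by apply: contraNneq pN => <-.
    have zq : z != q by apply: contraNneq qN => <-.
    by rewrite !inE (negPf zp) (negPf zq).
  case/set2P: xab xN => ->; case/set2P: ycd yN => -> yN xN.
  - exact: (drop a b c d).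
  - by apply: (drop a b d c) => //; rewrite 1?adjC // [[set d; c]]setUC.
  - by apply: (drop b a c d) => //; rewrite [[set b; a]]setUC.
  - apply: (drop b a d c) => //.
    by rewrite [[set b; a]]setUC [[set d; c]]setUC.
- exact: nonadj_nonface.
- exact: subsetUr.
- apply/negP => /subsetP/(_ a); rewrite setU11 => /(_ isT).
  by apply/negP/nab_cd; rewrite setU11.
- exact: nonadj_nonface.
- exact: subsetUl.
- apply/negP => /subsetP/(_ c); rewrite setU11 => /(_ isT).
  by move/nab_cd; rewrite setU11.
Qed.

End Necessary.

(** * The three families of graphs satisfy (S_2) *)
Section Sufficient.
Variables (k : fieldType) (n : nat) (G : sgraph 'I_n) (n_gt2 : 2 < n).
Hypothesis E_neq0 : edges G != set0.
Implicit Types (u v w a b : 'I_n) (C D N U : {set 'I_n}).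
Local Notation nonfaces := (nonfaces G).

Lemma nonface_neq0 N : N \in nonfaces -> exists u, u \in N.
Proof.
case: (set_0Vmem N) => [->|[u uN] _]; last by exists u.
case/set0Pn: E_neq0 => e; rewrite in_set => /existsP[x /existsP[y /andP[xy _]]].
by move/nonfacesP/(_ x y xy); rewrite sub0set.
Qed.

Lemma nonface_outside u v N : adj G u v -> N \in nonfaces ->
  exists w, [/\ w \in N, w != u & w != v].
Proof.
move=> uv /nonfacesP/(_ u v uv)/subsetPn[w wN].
by rewrite in_set2 negb_or => /andP[wu wv]; exists w.
Qed.

(** Exchanging one element at a time moves any c-subset to any other. *)
Lemma swap_connected (CC : {set {set 'I_n}}) c :
  (forall C, C \in CC <-> #|C| = c) -> locally_connected CC c.
Proof.
move=> CCE U C D /CCE cC /CCE cD CU DU.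
elim: {C}_.+1 {-2}C (ltnSn #|C :\: D|) cC CU => // m IHm C le_m cC CU.
have [/eqP|[x xCD]] := set_0Vmem (C :\: D).
  rewrite setD_eq0 => CD; suff -> : C = D by apply: connect0.
  by apply/eqP; rewrite eqEcard CD cC cD leqnn.
have [/eqP|[y yDC]] := set_0Vmem (D :\: C).
  rewrite setD_eq0 => DC; suff -> : C = D by apply: connect0.
  by apply/esym/eqP; rewrite eqEcard DC cC cD leqnn.
move: xCD yDC; rewrite !inE => /andP[xD xC] /andP[yC yD].
pose C' := y |: (C :\ x).
have yCx : y \notin C :\ x by rewrite !inE negb_and yC orbT.
have cC' : #|C'| = c by rewrite cardsU1 yCx -cC (cardsD1 x C) xC.
have C'U : C' \subset U.
  rewrite subUset sub1set (subsetP DU) //=.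
  exact: subset_trans (subsetDl _ _) CU.
apply: (@connect_trans _ _ C'); last first.
  apply: IHm => //; rewrite ltnS in le_m; apply: leq_trans le_m.
  apply: proper_card.
  apply/properP; split.
    apply/subsetP => z; rewrite !inE => /andP[zD].
    by case/orP => [/eqP zy|/andP[_ ->]]; [rewrite zy yD in zD | rewrite zD].
  exists x; first by rewrite !inE xD.
  rewrite !inE eqxx /= orbF negb_and; apply/orP; right.
  by apply: contraNneq yC => <-.
apply: connect1; apply/and3P; split=> //; first exact/CCE.
apply: (@leq_trans #|y |: C|).
  apply/subset_leq_card; rewrite subUset subsetUr setUS //.
  exact: subsetDl.
by rewrite cardsU1 yC cC.
Qed.

Lemma serre_complete : is_complete G ->
  serre_condition 2 {ideal_quot (comp_edge_ideal k G n_gt2)}.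
Proof.
move=> Gc; pose CC := [set C : {set 'I_n} | #|C| == 3].
have CCE C : C \in CC <-> #|C| = 3 by rewrite in_set; split=> /eqP.
apply: (serre2_of_connected (CC := CC) (c := 3)).
- move=> C /CCE C3; apply/nonfacesP => x y _; apply/negP => /subset_leq_card.
  by rewrite C3 cards2; case: (_ != _).
- move=> N NN; have [u uN] := nonface_neq0 NN.
  have [x nxu] : exists x, x != u.
    have /card_gt0P[x] : 0 < #|~: [set u]|.
      by rewrite cardsC1 card_ord; lia.
    by rewrite !inE => ?; exists x.
  have ux : adj G u x by apply: Gc; rewrite eq_sym.
  have [v [vN vu _]] := nonface_outside ux NN.
  have uv : adj G u v by apply: Gc; rewrite eq_sym.
  have [w [wN wu wv]] := nonface_outside uv NN.
  exists [set u; v; w]; last first.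
    by rewrite !subUset !sub1set uN vN.
  by apply/CCE; rewrite cards3 // eq_sym.
- by move=> C /CCE.
- exact: swap_connected.
Qed.

(** Without triangles the minimal nonfaces are the non-adjacent pairs.  Two disjoint such
pairs are joined through a non-adjacent pair of their vertices, which exists because
there is no 4-cycle. *)
Lemma serre_girth5 : (forall v, ~ isolated G v) ->
  (forall u v w, adj G u v -> adj G v w -> ~~ adj G w u) ->
  (forall a b c d, a != b -> c != d ->
     adj G a c -> adj G c b -> adj G b d -> ~~ adj G d a) ->
  serre_condition 2 {ideal_quot (comp_edge_ideal k G n_gt2)}.
Proof.
move=> niso notri nosq.
pose CC := [set C : {set 'I_n} | [exists u, exists v,
  [&& u != v, ~~ adj G u v & C == [set u; v]]]].
have CCP C : reflect (exists u v, [/\ u != v, ~~ adj G u v & C = [set u; v]])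
    (C \in CC).
  rewrite in_set; apply: (iffP existsP) => [[u /existsP[v /and3P[? ? /eqP ?]]]|].
    by exists u, v.
  by case=> u [v [? ? ->]]; exists u; apply/existsP; exists v; apply/and3P; split.
apply: (serre2_of_connected (CC := CC) (c := 2)).
- by move=> C /CCP[u [v [uv nadj ->]]]; apply: nonadj_nonface.
- move=> N NN; have [u uN] := nonface_neq0 NN.
  have pairN a b : a \in N -> b \in N -> a != b -> ~~ adj G a b ->
      exists2 C, C \in CC & C \subset N.
    move=> aN bN ab nadj; exists [set a; b]; first by apply/CCP; exists a, b.
    by rewrite subUset !sub1set aN.
  have [x ux] := nonisolatedP (niso u).
  have [v [vN vu _]] := nonface_outside ux NN.
  have [uv|nuv] := boolP (adj G u v); last by apply: (pairN u v); rewrite // eq_sym.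
  have [w [wN wu wv]] := nonface_outside uv NN.
  have [vw|nvw] := boolP (adj G v w); last by apply: (pairN v w); rewrite // eq_sym.
  exact: pairN (notri u v w uv vw).
- by move=> C /CCP[u [v [uv _ ->]]]; rewrite cards2 uv.
move=> U C D CCC CCD CU DU.
have share x y z : [set x; y] \in CC -> [set x; z] \in CC ->
    [set x; y] \subset U -> [set x; z] \subset U ->
    connect (adjacent_in CC 2 U) [set x; y] [set x; z].
  move=> Cxy Cxz xyU xzU; apply: connect1; apply/and3P; split=> //.
  have -> : [set x; y] :|: [set x; z] = z |: [set x; y].
    apply/setP => l; rewrite !inE.
    by case: (l == x); case: (l == y); case: (l == z).
  by rewrite cardsU1 cards2; case: (_ \notin _); case: (_ != _).
have [a [b [nab nadj_ab eC]]] := CCP _ CCC.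
have [c [d [ncd nadj_cd eD]]] := CCP _ CCD.
rewrite {}eC in CCC CU *; rewrite {}eD in CCD DU *.
have [aU bU] : a \in U /\ b \in U by apply/andP; rewrite -!sub1set -subUset.
have [cU dU] : c \in U /\ d \in U by apply/andP; rewrite -!sub1set -subUset.
have bridge x y z t : [set x; y] \in CC -> [set z; t] \in CC -> x \in U ->
    y \in U -> z \in U -> t \in U -> ~~ adj G x z ->
    connect (adjacent_in CC 2 U) [set x; y] [set z; t].
  move=> Cxy Czt xU yU zU tU nxz.
  have sub p q : p \in U -> q \in U -> [set p; q] \subset U.
    by move=> pU qU; rewrite subUset !sub1set pU.
  have [exz|xz] := eqVneq x z.
    by rewrite -exz in Czt *; apply: share; rewrite ?sub.
  have Cxz : [set x; z] \in CC by apply/CCP; exists x, z.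
  apply: (@connect_trans _ _ [set x; z]); first by apply: share; rewrite ?sub.
  rewrite [[set x; z]]setUC; apply: share; rewrite ?sub //.
  by rewrite setUC.
have Cba : [set b; a] \in CC by rewrite setUC.
have Cdc : [set d; c] \in CC by rewrite setUC.
have [ac|nac] := boolP (adj G a c); last exact: bridge.
have [cb|ncb] := boolP (adj G c b); last first.
  by rewrite [[set a; b]]setUC; apply: bridge; rewrite // adjC.
have [bd|nbd] := boolP (adj G b d); last first.
  by rewrite [[set a; b]]setUC [[set c; d]]setUC; apply: bridge.
have := nosq a b c d nab ncd ac cb bd; rewrite adjC => nad.
by rewrite [[set c; d]]setUC; apply: bridge.
Qed.

(** The ideal is generated by the product of the isolated vertices. *)
Lemma serre_one_edge a b v : isolated G v ->
  (forall x y, adj G x y -> [set x; y] = [set a; b]) ->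
  serre_condition 2 {ideal_quot (comp_edge_ideal k G n_gt2)}.
Proof.
move=> iso_v one_edge.
pose CC := [set C : {set 'I_n} | [exists u, `[< isolated G u >] && (C == [set u])]].
have CCP C : reflect (exists2 u, isolated G u & C = [set u]) (C \in CC).
  rewrite in_set; apply: (iffP existsP) => [[u /andP[/asboolP ? /eqP ?]]|].
    by exists u.
  by case=> u iso_u ->; exists u; rewrite eqxx andbT; apply/asboolP.
apply: (serre2_of_connected (CC := CC) (c := 1)).
- by move=> C /CCP[u iso_u ->]; apply: isolated_nonface.
- move=> N NN.
  case/set0Pn: E_neq0 => e; rewrite in_set => /existsP[x /existsP[y /andP[xy _]]].
  have [w [wN wx wy]] := nonface_outside xy NN.
  exists [set w]; last by rewrite sub1set.
  apply/CCP; exists w => // z; apply/negP => wz.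
  have : w \in [set x; y] by rewrite (one_edge x y xy) -(one_edge w z wz) setU11.
  by rewrite in_set2 (negPf wx) (negPf wy).
- by move=> C /CCP[u _ ->]; rewrite cards1.
move=> U C D CCC CCD CU DU; apply: connect1; apply/and3P; split=> //.
have [u _ ->] := CCP _ CCC; have [w _ ->] := CCP _ CCD.
by rewrite cards2; case: (_ != _).
Qed.

End Sufficient.

(** * Girth and isomorphism types *)
Section GirthFive.
Variables (n : nat) (G : sgraph 'I_n).

Lemma girth_ge5P : (EFin (Posz 5) <= girth G)%O <->
  (forall u v w, adj G u v -> adj G v w -> ~~ adj G w u) /\
  (forall a b c d, a != b -> c != d ->
     adj G a c -> adj G c b -> adj G b d -> ~~ adj G d a).
Proof.
rewrite nat_inf_geP; split=> [g5|[notri nosq] m [s]].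
  split=> [u v w uv vw|a b c d ab cd ac cb bd]; apply/negP => wu.
    suff : 5 <= 3 by [].
    apply: g5; exists [:: u; v; w] => //; apply/and3P; split=> //=.
      have [uv' uw vw'] := triangle_neq uv vw wu.
      by rewrite !inE negb_or uv' uw vw'.
    by rewrite uv vw wu.
  suff : 5 <= 4 by [].
  apply: g5; exists [:: a; c; b; d] => //; apply/and3P; split=> //=.
    rewrite !inE !negb_or ab cd (adj_neq ac) (adj_neq cb) (adj_neq bd).
    by rewrite eq_sym (adj_neq wu).
  by rewrite ac cb bd wu.
case/and3P; case: s => [|u [|v [|w [|x [|y s]]]]] //= _.
  rewrite !andbT => _ /and3P[uv vw wu] _.
  by have := notri u v w uv vw; rewrite wu.
  rewrite !inE !negb_or !andbT => /and3P[/and3P[uv uw ux] /andP[vw vx] wx].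
  case/and4P => auv avw awx axu _.
  by have := nosq u w v x uw vx auv avw awx; rewrite axu.
by move=> _ _ <-.
Qed.

End GirthFive.

Section OneEdge.
Variables (n : nat) (G : sgraph 'I_n).

Lemma isomorphic_one_edge s : 0 < s ->
  isomorphic G (disjoint_graph (complete_graph 2) (edgeless_graph s)) ->
  exists a b v, isolated G v /\ forall x y, adj G x y -> [set x; y] = [set a; b].
Proof.
case: s => // s _ [f [g fK gK] fE].
exists (g (inl ord0)), (g (inl ord_max)), (g (inr ord0)); split=> [u|x y].
  by rewrite -fE gK /=; case: (f u).
rewrite -fE -(fK x) -(fK y) !gK; case: (f x) => [i|i]; case: (f y) => [j|j] //=.
rewrite /complete_adj; case: i => [[|[|i]] //= lti]; case: j => [[|[|j]] //= ltj].
- move=> _; congr [set g (inl _); g (inl _)]; exact: val_inj.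
- by move=> _; rewrite setUC; congr [set g (inl _); g (inl _)]; exact: val_inj.
Qed.

Lemma one_edge_isomorphic a b v : isolated G v -> adj G a b ->
  (forall u, u != a -> u != b -> isolated G u) ->
  exists2 s, 0 < s &
    isomorphic G (disjoint_graph (complete_graph 2) (edgeless_graph s)).
Proof.
move=> iso_v ab iso_out; pose B := ~: [set a; b].
have vB : v \in B.
  rewrite !inE negb_or; apply/andP; split; apply/eqP => e; have := iso_v b.
    by rewrite e ab.
  by have := iso_v a; rewrite e adjC ab.
have nab := adj_neq ab.
exists #|B|; first by apply/card_gt0P; exists v.
pose f u : 'I_2 + 'I_#|B| := if u == a then inl ord0 else
  if u == b then inl ord_max else inr (enum_rank_in vB u).
pose g (z : 'I_2 + 'I_#|B|) : 'I_n := match z with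
  | inl i => if i == ord0 then a else b | inr j => enum_val j end.
have fK : cancel f g.
  move=> u; rewrite /f; case: eqP => [->//|/eqP ua]; case: eqP => [->//|/eqP ub] /=.
  by rewrite enum_rankK_in // !inE negb_or ua ub.
have gK : cancel g f.
  case=> [i|j] /=; rewrite /f.
    case: i => [[|[|i]] //= lti]; rewrite ?eqxx ?[b == a]eq_sym ?(negPf nab);
      congr inl; exact: val_inj.
  have := enum_valP j; rewrite !inE negb_or => /andP[/negPf-> /negPf->].
  by rewrite enum_valK_in.
exists f; first by exists g.
have iso_adj x y : x != a -> x != b -> adj G x y = false.
  by move=> xa xb; apply/negbTE/iso_out.
move=> x y; rewrite /f.
case: (eqVneq x a) => [->|xa]; last case: (eqVneq x b) => [->|xb]; last first.
- by rewrite iso_adj //; case: ifP => // _; case: ifP.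
all: case: (eqVneq y a) => [->|ya]; last case: (eqVneq y b) => [->|yb].
all: rewrite /= ?/complete_adj ?adj_irrefl ?eqxx ?ab //.
all: rewrite adjC ?ab //; by rewrite iso_adj.
Qed.

End OneEdge.

Theorem theorem4p2 (k : fieldType) (n : nat) (G : sgraph 'I_n)
    (n_ge3 : 3 <= n) (E_neq0 : edges G != set0) :
  serre_condition 2 {ideal_quot (comp_edge_ideal k G n_ge3)} <->
  ((forall v, ~ isolated G v) /\ (is_complete G \/ (EFin (5%:Z)%R <= girth G)%O))
  \/ (exists2 s : nat, 1 <= s &
        isomorphic G (disjoint_graph (complete_graph 2) (edgeless_graph s))).
Proof.
split=> [S2|[[niso [Gc|/girth_ge5P[notri nosq]]]|[s s_gt0 Giso]]]; last first.
- have [a [b [v [iso_v one]]]] := isomorphic_one_edge s_gt0 Giso.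
  exact: serre_one_edge iso_v one.
- exact: serre_girth5.
- exact: serre_complete.
have [[v iso_v]|noiso] := pselect (exists v, isolated G v); last first.
  have niso v : ~ isolated G v by move=> iso_v; apply: noiso; exists v.
  left; split=> //; have [Gc|nGc] := pselect (is_complete G); first by left.
  right; have notri u v w : adj G u v -> adj G v w -> ~~ adj G w u.
    by move=> uv vw; apply/negP => wu; apply/nGc/(triangle_complete S2 uv vw wu).
  apply/girth_ge5P; split=> // a b c d ab cd ac cb bd.
  have nab : ~~ adj G a b by rewrite adjC; apply: notri ac cb.
  have ncd : ~~ adj G c d by rewrite adjC; apply: notri cb bd.
  exact: (no_square S2 ab cd nab ncd ac cb bd).
right; case/set0Pn: (E_neq0) => e; rewrite in_set.
case/existsP => a /existsP[b /andP[ab _]].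
apply: (one_edge_isomorphic iso_v ab) => u ua ub; apply: contrapT => niso_u.
have niso_end x y : adj G x y -> ~ isolated G x.
  by move=> xy iso_x; have := iso_x y; rewrite xy.
have au : adj G b u.
  apply: (isolated_no_pair S2 iso_v) => //; last by rewrite eq_sym.
  by apply: (niso_end b a); rewrite adjC.
have := isolated_no_triangle S2 iso_v ab au; rewrite (isolated_no_pair S2 iso_v) //.
exact: niso_end ab.
Qed.
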